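(* Let $L>0$ and let $\alpha,\beta,\gamma,\lambda_1,\lambda_2$ be positive constants with $\alpha_1:=\alpha-\gamma^2\beta>0$. Assume that $f_1,f_2:\mathbb{R}^2\to\mathbb{R}$ satisfy conditions (G1), (G2), (G3) given in the context, with associated function $I\ge 0$ and constant $\eta>2$. Then for any initial data $$(\upsilon_0,p_0,\upsilon_1,p_1)\in\left(H^2(0,L)\cap H^1_*(0,L)\right)^2\times\left(H^1_*(0,L)\right)^2$$ (with $\upsilon_{0x}(L)=p_{0x}(L)=0$) satisfying $$E(0)=\frac12\left(\alpha_1\|\upsilon_{0x}\|_2^2+\beta\|\gamma\upsilon_{0x}-p_{0x}\|_2^2+\|\upsilon_1\|_2^2+\|p_1\|_2^2\right)-\int_0^L I(\upsilon_0,p_0)\,dx<0,$$ the corresponding solution $(\upsilon,p)$ of $$\begin{cases}\upsilon_{tt}-\alpha\upsilon_{xx}+\gamma\beta p_{xx}+\lambda_1\upsilon_t=f_1(\upsilon,p),\\ p_{tt}-\beta p_{xx}+\gamma\beta\upsilon_{xx}+\lambda_2p_t=f_2(\upsilon,p),\end{cases}\qquad x\in(0,L),\ t>0,$$ with initial conditions $\upsilon(x,0)=\upsilon_0(x)$, $\upsilon_t(x,0)=\upsilon_1(x)$, $p(x,0)=p_0(x)$, $p_t(x,0)=p_1(x)$ and boundary conditions $\upsilon(0,t)=\upsilon_x(L,t)=p(0,t)=p_x(L,t)=0$, blows up in finite time.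
   Context: $\|\cdot\|_2$ is the norm of $L^2(0,L)$. $H^1_*(0,L)=\{g\in H^1(0,L): g(0)=0\}$; functions in the $H^2$-components additionally satisfy $g_x(L)=0$. Conditions on the sources: (G1) There is a continuously differentiable function $I:\mathbb{R}^2\to[0,\infty)$, $I=I(\upsilon,p)$, with $\partial I/\partial\upsilon=f_1(\upsilon,p)$ and $\partial I/\partial p=f_2(\upsilon,p)$. (G2) There is a constant $\eta>2$ such that $\int_0^L[\upsilon f_1(\upsilon,p)+pf_2(\upsilon,p)-\eta I(\upsilon,p)]\,dx\ge0$ for all $\upsilon,p\in H^1_0(0,L)$. (G3) There is a constant $d>0$ such that for all $(\chi,\phi)\in\mathbb{R}^2$, $|f_1(\chi,\phi)|\le d(|\chi|^{\beta_1}+|\phi|^{\beta_2})$ and $|f_2(\chi,\phi)|\le d(|\chi|^{\beta_3}+|\phi|^{\beta_4})$, where $\beta_i\ge1$ and $(n-2)\beta_i\le n$ for $i=1,2,3,4$, $n$ being the space dimension (here $n=1$, so the last condition is automatic). A solution on $[0,T)$ means a strong solution: $\upsilon,p\in C([0,T);H^2(0,L)\cap H^1_*(0,L))\cap C^1([0,T);H^1_*(0,L))\cap C^2([0,T);L^2(0,L))$ satisfying the equations, the initial and the boundary conditions. For initial data $(\upsilon_0,p_0,\upsilon_1,p_1)\in\left(H^2(0,L)\cap H^1_*(0,L)\right)^2\times\left(H^1_*(0,L)\right)^2$ with $\upsilon_{0x}(L)=p_{0x}(L)=0$ the problem is taken to have a unique strong solution, defined on a maximal time interval. The solution blows up in finite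 time if it does not exist globally, i.e. its maximal time of existence is finite. *)

(* Defs.v *)
From HB Require Import structures.
From mathcomp Require Import all_boot all_order all_algebra.
From mathcomp Require Import all_classical all_reals all_analysis.

Set Implicit Arguments.
Unset Strict Implicit.
Unset Printing Implicit Defensive.
Import Order.TTheory GRing.Theory Num.Theory.
Import numFieldNormedType.Exports.

Local Open Scope classical_set_scope.
Local Open Scope ring_scope.

(* An element of a function space over (0, L) is represented by a function
   R -> R, of which only the a.e. class on (0, L) is meaningful. *)
Section function_spaces.
Context {R : realType} (L : R).

Local Notation mu := (@lebesgue_measure R).

Definition Omega : set R := `]0, L[%classic.

Definition L2 : set (R -> R) :=
  [set g | (g \_ Omega : R -> R) \in Lfun mu 2%:E].

Definition L2norm (g : R -> R) : R :=
  fine ('N[mu]_2%:E[EFin \o (g \_ Omega)])%E.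

Definition test_fun : set (R -> R) :=
  [set phi : R -> R | [/\ forall x : R, derivable phi x 1,
                 continuous (phi^`()%classic : R -> R),
                 compact (closure [set x | phi x != 0]) &
                 closure [set x | phi x != 0] `<=` Omega]].

Definition weak_derivative (g h : R -> R) : Prop :=
  forall phi, test_fun phi ->
    \int[mu]_(x in Omega) (g x * phi^`()%classic x) =
    - \int[mu]_(x in Omega) (h x * phi x).

Definition H1 : set (R -> R) :=
  [set g | L2 g /\ exists2 h, L2 h & weak_derivative g h].

(* A choice of the weak derivative, which is unique a.e. on (0, L) for g in H1. *)
Definition wderiv (g : R -> R) : R -> R :=
  xget (cst 0) [set h | L2 h /\ weak_derivative g h].

Definition H2 : set (R -> R) := [set g | H1 g /\ H1 (wderiv g)].

(* Boundary values are those of the representative that is continuous on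
   [0, L]; for g in H1 it exists and is unique on [0, L]. *)
Definition crep (g : R -> R) : R -> R :=
  xget (cst 0) [set h | {within `[0, L], continuous h} /\
                        h = g %[ae mu in Omega]].

Definition H1star : set (R -> R) := [set g | H1 g /\ crep g 0 = 0].

Definition H1norm (g : R -> R) : R :=
  Num.sqrt (L2norm g ^+ 2 + L2norm (wderiv g) ^+ 2).

Definition H2norm (g : R -> R) : R :=
  Num.sqrt (L2norm g ^+ 2 + L2norm (wderiv g) ^+ 2
            + L2norm (wderiv (wderiv g)) ^+ 2).

(* H^1_0(0, L): the closure of the test functions in H^1(0, L). *)
Definition H10 : set (R -> R) :=
  [set g | H1 g /\ forall e, 0 < e ->
     exists2 phi, test_fun phi & H1norm (fun x => g x - phi x) < e].

End function_spaces.

(* Time regularity on [0, T), 0 < T <= +oo, of w : t |-> w t with values in the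
   space V of functions of x normed by N; at t = 0 limits are one-sided. *)
Section time_regularity.
Context {R : realType} (V : set (R -> R)) (N : (R -> R) -> R) (T : \bar R).

Definition time_dom : set R := [set t | 0 <= t /\ (t%:E < T)%E].

Definition class_C0 (w : R -> R -> R) : Prop :=
  (forall t, time_dom t -> V (w t)) /\
  (forall t, time_dom t ->
     N (fun x => w s x - w t x) @[s --> within time_dom (nbhs t)] --> (0 : R)).

Definition class_C1 (w w' : R -> R -> R) : Prop :=
  [/\ class_C0 w, class_C0 w' &
      forall t, time_dom t ->
        N (fun x => (s - t)^-1 * (w s x - w t x) - w' t x)
          @[s --> within time_dom t^'] --> (0 : R)].

Definition class_C2 (w w' w'' : R -> R -> R) : Prop :=
  class_C1 w w' /\ class_C1 w' w''.

End time_regularity.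

Section sources.
Context {R : realType}.

Definition G1 (I f1 f2 : R -> R -> R) : Prop :=
  [/\ forall v p, 0 <= I v p,
      forall z : R * R, differentiable (fun z : R * R => I z.1 z.2) z,
      forall v p : R, is_derive v 1 (fun v' => I v' p) (f1 v p) /\
                  is_derive p 1 (fun p' => I v p') (f2 v p),
      continuous (fun z : R * R => f1 z.1 z.2) &
      continuous (fun z : R * R => f2 z.1 z.2)].

Definition G2 (L : R) (I f1 f2 : R -> R -> R) (eta : R) : Prop :=
  forall v p, H10 L v -> H10 L p ->
    0 <= \int[@lebesgue_measure R]_(x in Omega L)
           (v x * f1 (v x) (p x) + p x * f2 (v x) (p x) - eta * I (v x) (p x)).

(* In space dimension n = 1 the requirement (n - 2) b <= n is void. *)
Definition G3 (f1 f2 : R -> R -> R) : Prop :=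
  exists d b1 b2 b3 b4 : R,
    [/\ 0 < d, [/\ 1 <= b1, 1 <= b2, 1 <= b3 & 1 <= b4],
        forall x y, `|f1 x y| <= d * (`|x| `^ b1 + `|y| `^ b2) &
        forall x y, `|f2 x y| <= d * (`|x| `^ b3 + `|y| `^ b4)].

End sources.

Section problem.
Context {R : realType} (L alpha beta gamma lambda1 lambda2 : R).
Context (f1 f2 : R -> R -> R) (v0 p0 v1 p1 : R -> R).

Local Notation mu := (@lebesgue_measure R).
Local Notation dx := (wderiv L).

Definition regular (T : \bar R) (w wt wtt : R -> R -> R) : Prop :=
  [/\ class_C0 (H2 L `&` H1star L) (H2norm L) T w,
      class_C1 (H1star L) (H1norm L) T w wt &
      class_C2 (L2 L) (L2norm L) T w wt wtt].

Definition strong_solution (T : \bar R) (v p : R -> R -> R) : Prop :=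
  (0%:E < T)%E /\
  exists vt vtt pt ptt : R -> R -> R,
  [/\ regular T v vt vtt /\ regular T p pt ptt,
      forall t : R, 0 < t -> (t%:E < T)%E -> \forall x \ae mu, Omega L x ->
        vtt t x - alpha * dx (dx (v t)) x + gamma * beta * dx (dx (p t)) x
          + lambda1 * vt t x = f1 (v t x) (p t x),
      forall t : R, 0 < t -> (t%:E < T)%E -> \forall x \ae mu, Omega L x ->
        ptt t x - beta * dx (dx (p t)) x + gamma * beta * dx (dx (v t)) x
          + lambda2 * pt t x = f2 (v t x) (p t x),
      [/\ v 0 = v0 %[ae mu in Omega L], vt 0 = v1 %[ae mu in Omega L],
          p 0 = p0 %[ae mu in Omega L] & pt 0 = p1 %[ae mu in Omega L]] &
      forall t, time_dom T t ->
        [/\ crep L (v t) 0 = 0, crep L (dx (v t)) L = 0,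
            crep L (p t) 0 = 0 & crep L (dx (p t)) L = 0]].

Definition maximal_strong_solution (T : \bar R) (v p : R -> R -> R) : Prop :=
  strong_solution T v p /\
  forall T' v' p', strong_solution T' v' p' ->
    (forall t, time_dom T t -> v' t = v t %[ae mu in Omega L] /\
                               p' t = p t %[ae mu in Omega L]) ->
    (T' <= T)%E.

Definition initial_energy (I : R -> R -> R) : R :=
  2^-1 * ((alpha - gamma ^+ 2 * beta) * L2norm L (dx v0) ^+ 2
          + beta * L2norm L (fun x => gamma * dx v0 x - dx p0 x) ^+ 2
          + L2norm L v1 ^+ 2 + L2norm L p1 ^+ 2)
  - \int[mu]_(x in Omega L) I (v0 x) (p0 x).

End problem.

(* Main.v *)
(** Levine's concavity method. Suppose the solution is global. With
    A = |v|^2 + |p|^2, D = lambda1 |v|^2 + lambda2 |p|^2, M = (v, v_t) + (p, p_t)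
    and H = - E, the equations give A' = 2 M, D' = 2 N, H' = lambda1 |v_t|^2 +
    lambda2 |p_t|^2 >= 0, and, by (G2), M' + N >= (1 + eta/2) K + eta H with
    K = |v_t|^2 + |p_t|^2. Hence, for suitable b, t0 and T, the functional
    F t = A t + \int_0^t D + (T - t) D 0 + b (t + t0)^2 satisfies
    F F'' >= (1 + nu) F'^2 with nu = (eta - 2) / 4 > 0, so that F / F' decreases at
    rate at least nu and becomes negative before time T, which is absurd.
    (G2) is only assumed for functions vanishing at both ends of the interval;
    testing it with multiples of plateau functions increasing to 1 shows that the
    integrand is nonnegative pointwise, so it may be used for v(L), p(L) <> 0. *)

Require Import Defs.
From HB Require Import structures.
From mathcomp Require Import all_boot all_order all_algebra.
From mathcomp Require Import all_classical all_reals all_analysis.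
From mathcomp Require Import measurable_realfun.
From mathcomp Require Import ring lra.
Import Order.TTheory GRing.Theory Num.Theory.
Import numFieldNormedType.Exports.
Local Open Scope classical_set_scope.
Local Open Scope ring_scope.

Set Implicit Arguments.
Unset Strict Implicit.
Unset Printing Implicit Defensive.

(** * Concavity argument for scalar functions of time *)

(** The damping dictates the shape of F. The summand \int_0^t D + (T - t) D 0 contributes N to F'' /
    2, which is what (G2) controls, and its derivative D t - D 0 is the time integral of 2 N, which
    Cauchy-Schwarz pairs with the time integrals of D and of H', the latter being H t - H 0. The
    price is the term T D 0 in F 0: the horizon T occurs on both sides of the final inequality, and
    a large shift t0 restores the balance. The choice b = H 0 turns K + (H - H 0) + b into K + H,
    and nu is fixed by 2 (1 + nu) = 1 + eta / 2, the weight of K in the virial inequality. On the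
    analytic side the obstacle is that a solution is given in x only up to null sets and in t only
    through norms. Weak derivatives are therefore converted into primitives, integration by parts
    into Fubini's theorem on a triangle, and derivatives of integrals in t into limits of scalar
    products. No boundary term survives, because the fluxes vanish at L and the functions tested
    with vanish at 0. *)

Lemma le_of_derive_ge0 (R : realType) (f df : R -> R) (T : R) :
  {within `[0, T], continuous f} ->
  (forall t, 0 < t -> t < T -> is_derive t 1 f (df t)) ->
  (forall t, 0 < t -> t < T -> 0 <= df t) ->
  forall t, 0 <= t <= T -> f 0 <= f t.
Proof.
move=> cf f' df0 t /andP[t0 tT].
have cft : {within `[0, t], continuous f}.
  apply: continuous_subspaceW cf => x /=; rewrite !in_itv/= => /andP[-> /le_trans].
  exact.
move: t0; rewrite le_eqVlt => /predU1P[<-//|t0].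
have [|c /[!in_itv]/= /andP[c0 ct] E] := @MVT _ f df 0 t t0 _ cft.
  move=> x; rewrite in_itv/= => /andP[x0 xt]; apply: f' => //.
  exact: lt_le_trans xt tT.
rewrite -subr_ge0 E mulr_ge0 ?subr0 ?(ltW t0)//.
by apply: df0 => //; exact: lt_le_trans ct tT.
Qed.

Lemma le_lin_of_derive_le (R : realType) (f df : R -> R) (T k : R) :
  {within `[0, T], continuous f} ->
  (forall t, 0 < t -> t < T -> is_derive t 1 f (df t)) ->
  (forall t, 0 < t -> t < T -> df t <= k) ->
  forall t, 0 <= t <= T -> f t <= f 0 + k * t.
Proof.
move=> cf f' df0 t tT.
pose g x := k * x - f x.
have := @le_of_derive_ge0 _ g (fun x => k - df x) T _ _ _ t tT.
rewrite /g mulr0 sub0r => H.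
suff : - f 0 <= k * t - f t by lra.
apply: H.
- move=> x; apply: cvgB; last exact: cf.
  apply: cvgM; first exact: cvg_cst.
  by apply: continuous_subspaceT => y; exact: cvg_id.
- move=> s s0 sT; have := f' s s0 sT => Ds.
  rewrite (_ : (fun _ => _) = (k *: id) - f)//.
  by apply: is_derive_eq; rewrite /GRing.scale/= mulr1.
- by move=> s s0 sT; rewrite subr_ge0 df0.
Qed.

(** Cauchy-Schwarz is used in this discriminant form, both for [ip_CS] and for the bound on [P]:
    nonnegative quadratics in the same r can be added before the discriminant is taken. *)
Lemma quad_disc (R : realType) (a b c : R) : 0 <= a ->
  (forall r, 0 <= a + 2 * r * b + r ^+ 2 * c) -> 0 <= c /\ b ^+ 2 <= a * c.
Proof.
move=> a0 H.
have c0 : 0 <= c.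
  rewrite leNgt; apply/negP => c0.
  (* For c < 0 this r is at least 1 and c r = c - a - 2 |b|, so r^2 c outweighs a + 2 r b. *)
  set r := 1 + (a + 2 * `|b|) / (- c).
  have : 1 <= r by rewrite lerDl divr_ge0// ?addr_ge0// ?mulr_ge0// oppr_ge0 ltW.
  have E : c * r = c - a - 2 * `|b|.
    rewrite /r mulrDr mulr1 mulrCA; field; lra.
  have := H r; have : b <= `|b| by rewrite ler_norm.
  have : 0 <= `|b| by []. 
  move: E; set B := `|b|; clearbody r B => E B0 bB H1 r1.
  have : r ^+ 2 * c = r * (c - a - 2 * B) by rewrite -E; ring.
  nra.
split=> //.
case: (eqVneq c 0) => [c00|cn0].
  subst c; rewrite mulr0.
  case: (eqVneq b 0) => [->|bn0]; first by rewrite expr0n.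
  (* With c = 0 the expression is affine in r with nonzero slope; here it takes the value -1. *)
  have := H (- (a + 1) / (2 * b)).
  have -> : a + 2 * (- (a + 1) / (2 * b)) * b + (- (a + 1) / (2 * b)) ^+ 2 * 0 = -1.
    by field.
  lra.
have cp : 0 < c by rewrite lt_neqAle eq_sym cn0.
(* The minimiser of the quadratic, where its value is (a c - b^2) / c. *)
have := H (- b / c).
have -> : a + 2 * (- b / c) * b + (- b / c) ^+ 2 * c = (a * c - b ^+ 2) / c.
  by field.
by rewrite pmulr_lge0 ?invr_gt0// subr_ge0.
Qed.

(** Lets the time integral of [D] enter the concavity argument only through its value at 0, its
    continuity and its derivative. *)
Lemma ex_antiderivative (R : realType) (D : R -> R) (T : R) : 0 < T ->
  {within `[0, T], continuous D} ->
  (forall t, 0 < t -> t < T -> {for t, continuous D}) ->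
  exists S : R -> R, [/\ S 0 = 0, {within `[0, T], continuous S} &
    forall t, 0 < t -> t < T -> is_derive t 1 S (D t)].
Proof.
move=> T0 cD cD'.
have iD : (@lebesgue_measure R).-integrable `[0, T] (EFin \o D).
  by apply: continuous_compact_integrable => //; exact: segment_compact.
exists (fun x => parameterized_integral (@lebesgue_measure R) 0 x D); split.
- by rewrite /parameterized_integral set_itv1 Rintegral_set1.
- by apply: parameterized_integral_continuous => //; exact: ltW.
- move=> t t0 tT.
  have [d E] := @continuous_FTC1_closed _ D 0 t T tT iD t0 (cD' t t0 tT).
  by apply: DeriveDef; [exact: d|rewrite -derive1E].
Qed.

Lemma continuous_of_derive (R : realType) (f : R -> R) (t l : R) :
  is_derive t 1 f l -> {for t, continuous f}.
Proof. by case=> d _; apply: differentiable_continuous; apply/derivable1_diffP. Qed.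

(** One shape serves sums (k = 1), differences (k = -1) and weighted sums, so that derivatives of
    long combinations are built by application. *)
Lemma is_deriveDZ (R : realType) (f g : R -> R) (k t df dg : R) :
  is_derive t 1 f df -> is_derive t 1 g dg ->
  is_derive t 1 (fun x => f x + k * g x) (df + k * dg).
Proof.
move=> h1 h2. 
have -> : (fun x => f x + k * g x) = f + (k \*: g).
  by apply/funext => x; rewrite !fctE.
have h3 := is_deriveZ k h2.
have h4 := is_deriveD h1 h3.
have -> : df + k * dg = df + k *: dg by rewrite /GRing.scale.
exact: h4.
Qed.

Lemma is_deriveZl (R : realType) (g : R -> R) (k t dg : R) :
  is_derive t 1 g dg -> is_derive t 1 (fun x => k * g x) (k * dg).
Proof.
move=> h2.
have -> : (fun x => k * g x) = k \*: g by apply/funext.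
have h3 := is_deriveZ k h2.
have -> : k * dg = k *: dg by rewrite /GRing.scale.
exact: h3.
Qed.

Lemma is_deriveDcst (R : realType) (f : R -> R) (k t df : R) :
  is_derive t 1 f df -> is_derive t 1 (fun x => f x + k) df.
Proof.
move=> ?; rewrite (_ : (fun _ => _) = f + cst k)//.
by apply: is_derive_eq; rewrite addr0.
Qed.

Lemma is_derive_shift2 (R : realType) (k t : R) :
  is_derive t 1 (fun x => (x + k) ^+ 2) (2 * (t + k)).
Proof.
rewrite (_ : (fun _ => _) = (id + cst k) ^+ 2).
  by apply: is_derive_eq; rewrite /GRing.scale/= !fctE; ring.
by apply/funext => x; rewrite !fctE.
Qed.

Lemma is_derive_ratio (R : realType) (f g : R -> R) (t df dg : R) :
  g t != 0 -> is_derive t 1 f df -> is_derive t 1 g dg ->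
  is_derive t 1 (fun x => f x * (g x)^-1) (df / g t - f t * dg / g t ^+ 2).
Proof.
move=> gt0 hf hg; have h := is_deriveV gt0 hg.
have -> : (fun x => f x * (g x)^-1) = f * (fun x => (g x)^-1) by [].
apply: is_derive_eq (is_deriveM hf h) _.
by rewrite /GRing.scale/=; field.
Qed.

Section concavity.
Context {R : realType}.
Variables (A D M N K KD H dM : R -> R) (eta : R).
Hypothesis eta2 : 2 < eta.
Hypothesis cA : {within `[0, +oo[, continuous A}.
Hypothesis cD : {within `[0, +oo[, continuous D}.
Hypothesis cM : {within `[0, +oo[, continuous M}.
Hypothesis cH : {within `[0, +oo[, continuous H}.
Hypothesis dA : forall t : R, 0 < t -> is_derive t 1 A (2 * M t).
Hypothesis dD : forall t : R, 0 < t -> is_derive t 1 D (2 * N t).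
Hypothesis dH : forall t : R, 0 < t -> is_derive t 1 H (KD t).
Hypothesis dMP : forall t : R, 0 < t -> is_derive t 1 M (dM t).
Hypothesis dM_ge : forall t : R, 0 < t ->
  (1 + eta / 2) * K t + eta * H t <= dM t + N t.
Hypothesis A0 : forall t : R, 0 <= t -> 0 <= A t.
Hypothesis D0 : forall t : R, 0 <= t -> 0 <= D t.
Hypothesis KD0 : forall t : R, 0 <= t -> 0 <= KD t.
(** The squared norm of (v + r v_t, p + r p_t). Cauchy-Schwarz is kept in this form so that it can
    be integrated in time and added to other such forms with the same r. *)
Hypothesis qA : forall t r : R, 0 <= t -> 0 <= A t + 2 * r * M t + r ^+ 2 * K t.
Hypothesis qD : forall t r : R, 0 <= t -> 0 <= D t + 2 * r * N t + r ^+ 2 * KD t.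
Hypothesis H0 : 0 < H 0.

Let within_itv (f : R -> R) T : {within `[0, +oo[, continuous f} ->
  {within `[0, T], continuous f}.
Proof.
by apply: continuous_subspaceW => x /=; rewrite !in_itv/= => /andP[->].
Qed.

(* P = F' / 2; the Cauchy-Schwarz inequality gives P ^ 2 <= a c, and a <= F on [0, T]. *)
Section interval.
Variables (S : R -> R) (T b t0 nu : R).
Hypothesis T_gt0 : 0 < T.
Hypothesis S0 : S 0 = 0.
Hypothesis cS : {within `[0, T], continuous S}.
Hypothesis dS : forall t : R, 0 < t -> t < T -> is_derive t 1 S (D t).
Hypothesis bE : b = H 0.
Hypothesis nuE : nu = (eta - 2) / 4.

Let F t := A t + S t + D 0 * (T - t) + b * (t + t0) ^+ 2.
Let P t := M t + 2^-1 * D t - 2^-1 * D 0 + b * (t + t0).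
(** Three pairs are collected in [a], [P] and [c]: (v, p) with (v_t, p_t), the damping-weighted
    version of it integrated in time, and sqrt b (t + t0) with its derivative sqrt b. *)
Let c t := K t + (H t - H 0) + b.
Let a t := A t + S t + b * (t + t0) ^+ 2.

Hypothesis P_gt0 : 0 < P 0.

Let H_ge t : 0 <= t <= T -> H 0 <= H t.
Proof.
move=> tT; apply: (@le_of_derive_ge0 _ H KD T) => //.
- exact: within_itv.
- by move=> s s0 _; exact: dH.
- by move=> s s0 _; exact: KD0 (ltW s0).
Qed.

(** The expression vanishes at t = 0 and its derivative is the form of [qD]: this is [qD] integrated
    in time. *)
Let qS t r : 0 <= t <= T -> 0 <= S t + r * (D t - D 0) + r ^+ 2 * (H t - H 0).
Proof.
move=> tT.
pose g := S + r *: D + (r ^+ 2) *: H.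
have := @le_of_derive_ge0 _ g (fun t => D t + 2 * r * N t + r ^+ 2 * KD t) T _ _ _ t tT.
rewrite /g /= !fctE /GRing.scale/= S0 => Hg.
suff : 0 + r * D 0 + r ^+ 2 * H 0 <= S t + r * D t + r ^+ 2 * H t by lra.
apply: Hg.
- move=> x; apply: cvgD; first apply: cvgD; first exact: cS.
  + by apply: cvgM; [exact: cvg_cst|exact: (within_itv cD)].
  + by apply: cvgM; [exact: cvg_cst|exact: (within_itv cH)].
- move=> s s0 sT; have ? := dS s0 sT; have ? := dD s0; have ? := dH s0.
  by apply: is_derive_eq; rewrite /GRing.scale/=; ring.
- by move=> s s0 _; exact: qD (ltW s0).
Qed.

Let S_ge0 t : 0 <= t <= T -> 0 <= S t.
Proof. by move=> tT; have := qS 0 tT; rewrite expr0n/= !mul0r !addr0. Qed.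

Let b_gt0 : 0 < b. Proof. by rewrite bE. Qed.

Let a_ge0 t : 0 <= t <= T -> 0 <= a t.
Proof.
move=> tT; have /andP[t_0 _] := tT; rewrite /a.
by rewrite !addr_ge0 ?A0 ?S_ge0// mulr_ge0 ?sqr_ge0// ltW.
Qed.

Let P2_le t : 0 <= t <= T -> 0 <= c t /\ P t ^+ 2 <= a t * c t.
Proof.
move=> tT; have /andP[t_0 _] := tT.
apply: quad_disc; first exact: a_ge0.
move=> r; have := qA r t_0; have := qS r tT.
(* The third quadratic form; in the sum of the three the linear term is exactly 2 r P. *)
have : 0 <= b * ((t + t0) + r) ^+ 2 by rewrite mulr_ge0 ?sqr_ge0// ltW.
rewrite /a /c /P; set X := A t; set Y := S t; set Z := H t - H 0.
by lra.
Qed.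

Let a_le_F t : 0 <= t <= T -> a t <= F t.
Proof.
move=> /andP[t_0 tT]; rewrite /a /F.
have : 0 <= D 0 * (T - t) by rewrite mulr_ge0 ?D0// subr_ge0.
by lra.
Qed.

Let dP (t : R) : 0 < t -> is_derive t 1 P (dM t + N t + b).
Proof.
move=> s0; have hM := dMP s0; have hD := dD s0.
have h := is_deriveDcst t0 (is_derive_id t 1).
have := is_deriveDZ b (is_deriveDcst (- (2^-1 * D 0)) (is_deriveDZ 2^-1 hM hD)) h.
by rewrite mulrA mulVf// mul1r mulr1.
Qed.

(** As b = H 0, [c] equals K + H; as 2 (1 + nu) = 1 + eta / 2, the surplus left by [dM_ge] is (eta -
    2) H / 2 + b, which is positive because H stays above H 0 > 0. *)
Let dP_ge t : 0 < t -> t < T -> 2 * (1 + nu) * c t <= dM t + N t + b.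
Proof.
move=> t_0 tT; have tT' : 0 <= t <= T by rewrite !ltW.
have h1 := H_ge tT'; have := dM_ge t_0; rewrite -(lerD2r b) /c nuE bE.
have h2 : 0 <= (eta - 2) * H t.
  rewrite mulr_ge0 ?subr_ge0 ?(ltW eta2)//; exact: le_trans (ltW H0) h1.
apply: le_trans; rewrite -subr_ge0.
have -> : forall x y z e : R, (1 + e / 2) * x + e * y + z
  - 2 * (1 + (e - 2) / 4) * (x + (y - z) + z) = (e - 2) * y / 2 + z by move=> *; field.
by rewrite addr_ge0 ?divr_ge0// ltW.
Qed.

Let cid : {within `[0, T], continuous (@id R)}.
Proof. by apply: continuous_subspaceT => y; exact: cvg_id. Qed.

Let cP : {within `[0, T], continuous P}.
Proof.
move=> x; rewrite /P; apply: cvgD; first apply: cvgB; first apply: cvgD.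
- exact: (within_itv cM).
- by apply: cvgM; [exact: cvg_cst|exact: (within_itv cD)].
- exact: cvg_cst.
- apply: cvgM; first exact: cvg_cst.
  by apply: cvgD; [exact: cid|exact: cvg_cst].
Qed.

Let cF : {within `[0, T], continuous F}.
Proof.
move=> x; rewrite /F; apply: cvgD; first apply: cvgD; first apply: cvgD.
- exact: (within_itv cA).
- exact: cS.
- apply: cvgM; first exact: cvg_cst.
  by apply: cvgB; [exact: cvg_cst|exact: cid].
- apply: cvgM; first exact: cvg_cst.
  by apply: cvgM; apply: cvgD; [exact: cid|exact: cvg_cst|exact: cid|exact: cvg_cst].
Qed.

Let nu1_ge0 : 0 <= 2 * (1 + nu).
Proof. by rewrite nuE mulr_ge0// addr_ge0// divr_ge0// subr_ge0 ltW. Qed.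

Let P_ge t : 0 <= t <= T -> P 0 <= P t.
Proof.
move=> tT; apply: (@le_of_derive_ge0 _ P (fun t => dM t + N t + b) T) => //.
- by move=> s s0 _; exact: dP.
- move=> s s0 sT; apply: le_trans (dP_ge s0 sT).
  have sT' : 0 <= s <= T by rewrite !ltW.
  by rewrite mulr_ge0 ?(P2_le sT').1.
Qed.

Let dF (t : R) : 0 < t -> t < T -> is_derive t 1 F (2 * P t).
Proof.
move=> s0 sT; have hA := dA s0; have hS := dS s0 sT.
have h := is_deriveDcst (- T) (is_derive_id t 1).
rewrite (_ : F = fun x => (A x + 1 * S x) + - D 0 * (x + - T) + b * (x + t0) ^+ 2).
  have -> : 2 * P t = (2 * M t + 1 * D t) + - D 0 * 1 + b * (2 * (t + t0)).
    by rewrite /P; field.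
  have h1 := is_deriveDZ (- D 0) (is_deriveDZ 1 hA hS) h.
  have h2 := is_deriveDZ b h1 (is_derive_shift2 t0 t).
  exact: h2.
by apply/funext => x; rewrite /F; ring.
Qed.

(** The ratio z = F / P satisfies z' = 2 - F P' / P^2 <= - 2 nu, so z T >= 0 forces 2 nu T <= z 0.
    Compared with the power F^(- nu), the ratio avoids real exponents and asks strict positivity of
    [P] only. *)
Lemma F_ge_T : 2 * nu * T * P 0 <= F 0.
Proof.
have T0T : 0 <= T <= T by apply/andP; split => //; exact: ltW.
have Pp t : 0 <= t <= T -> 0 < P t by move=> /P_ge; exact: lt_le_trans.
pose z t := F t * (P t)^-1.
have := @le_lin_of_derive_le _ z
  (fun t => 2 - F t * (dM t + N t + b) / P t ^+ 2) T (- (2 * nu)) _ _ _ T T0T.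
have zT : 0 <= z T.
  rewrite /z mulr_ge0 ?invr_ge0 ?(ltW (Pp _ T0T))//.
  exact: le_trans (a_ge0 T0T) (a_le_F T0T).
have z0 : z 0 * P 0 = F 0 by rewrite /z mulfVK// gt_eqF.
move=> Hz; rewrite -z0 ler_wpM2r ?(ltW P_gt0)//.
suff : z T <= z 0 + - (2 * nu) * T by lra.
apply: Hz.
- apply/subspace_continuousP => x xT; apply: cvgM.
    exact: (subspace_continuousP _ _).1 cF _ xT.
  apply: cvgV; last exact: (subspace_continuousP _ _).1 cP _ xT.
  by rewrite gt_eqF// Pp//; move: xT; rewrite /= in_itv.
- move=> t t_0 tT; have tT' : 0 <= t <= T by rewrite !ltW.
  have dPt := dP t_0; have dFt := dF t_0 tT.
  have Pn0 : P t != 0 by rewrite gt_eqF// Pp.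
  by have := is_derive_ratio Pn0 dFt dPt; rewrite mulfK.
- move=> t t_0 tT; have tT' : 0 <= t <= T by rewrite !ltW.
  have [c0 Pac] := P2_le tT'.
  have P2 : 0 < P t ^+ 2 by rewrite exprn_gt0// Pp.
  have F0 : 0 <= F t by apply: le_trans (a_le_F tT'); exact: a_ge0.
  suff : 2 * (1 + nu) <= F t * (dM t + N t + b) / P t ^+ 2 by lra.
  rewrite ler_pdivlMr//.
  (* F P' >= 2 (1 + nu) F c >= 2 (1 + nu) a c >= 2 (1 + nu) P^2. *)
  apply: le_trans (_ : F t * (2 * (1 + nu) * c t) <= _); last first.
    by rewrite ler_wpM2l// dP_ge.
  rewrite [leRHS]mulrCA ler_wpM2l//; apply: le_trans Pac _.
  by rewrite ler_wpM2r// a_le_F.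
Qed.

End interval.

Theorem concavity_blowup : False.
Proof.
pose nu := (eta - 2) / 4.
have nu0 : 0 < nu by rewrite /nu divr_gt0// subr_gt0.
have nu20 : 0 < 2 * nu by rewrite mulr_gt0.
pose b := H 0.
(* Since F 0 contains T D 0, a suitable T exists only if 2 nu P 0 > D 0; the shift makes P 0 = M 0 +
   b t0 exceed D 0 / (2 nu). *)
pose t0 := (D 0 / (2 * nu) + `|M 0| + 1) / b.
pose P0 := M 0 + b * t0.
have bt0 : b * t0 = D 0 / (2 * nu) + `|M 0| + 1.
  by rewrite /t0 mulrC divfK// gt_eqF.
have P0D : D 0 < 2 * nu * P0.
  have -> : D 0 = 2 * nu * (D 0 / (2 * nu)) by rewrite mulrC divfK// gt_eqF.
  rewrite ltr_pM2l//.
  rewrite /P0 bt0; have : - M 0 <= `|M 0| by rewrite -normrN ler_norm.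
  lra.
(* The inequality 2 nu T P 0 <= A 0 + T D 0 + b t0^2 fails as soon as T exceeds this quotient; hence
   the added 1. *)
pose T := (A 0 + b * t0 ^+ 2) / (2 * nu * P0 - D 0) + 1.
have A00 : 0 <= A 0 by exact: A0.
have T0 : 0 < T.
  rewrite ltr_wpDl// divr_ge0//; last by rewrite subr_ge0 ltW.
  by rewrite addr_ge0// mulr_ge0 ?sqr_ge0 ?(ltW H0).
have [|S [S0 cS dS]] := @ex_antiderivative _ D T T0 (within_itv cD).
  by move=> t t_0 _; exact: continuous_of_derive (dD t_0).
have P0gt0 : 0 < P0.
  by rewrite -(pmulr_rgt0 _ nu20); apply: le_lt_trans P0D; exact: D0.
have PE : M 0 + 2^-1 * D 0 - 2^-1 * D 0 + b * (0 + t0) = P0.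
  by rewrite addrK add0r.
have := @F_ge_T S T b t0 nu T0 S0 cS dS erefl erefl.
cbv zeta; rewrite PE S0 addr0 subr0 !add0r => /(_ P0gt0).
apply/negP; rewrite -ltNge.
have : T * (2 * nu * P0 - D 0) = (A 0 + b * t0 ^+ 2) + (2 * nu * P0 - D 0).
  by rewrite /T mulrDl mul1r divfK// gt_eqF// subr_gt0.
lra.
Qed.

End concavity.

(** * The space L2(0, L) *)

Section L2_theory.
Context {R : realType} (L : R).
Local Notation mu := (@lebesgue_measure R).
Local Notation Om := (Omega L).
Local Notation integrable f := (mu.-integrable Om (fun x => (f x)%:E)).

Lemma aeS (P Q : R -> Prop) : (forall x, P x -> Q x) ->
  (\forall x \ae mu, P x) -> \forall x \ae mu, Q x.
Proof. by move=> PQ; apply: filterS PQ; exact: (ae_filter_ringOfSetsType mu). Qed.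

Lemma aeS2 (P P' Q : R -> Prop) : (forall x, P x -> P' x -> Q x) ->
  (\forall x \ae mu, P x) -> (\forall x \ae mu, P' x) -> \forall x \ae mu, Q x.
Proof. by move=> PQ; apply: filterS2 PQ; exact: (ae_filter_ringOfSetsType mu). Qed.

Definition ip (g h : R -> R) : R := \int[mu]_(x in Om) (g x * h x).

Lemma measurable_Omega : measurable Om.
Proof. exact: measurable_itv. Qed.
Local Hint Resolve measurable_Omega : core.

Lemma mu_Omega_lty : (mu Om < +oo)%E.
Proof.
rewrite /Omega lebesgue_measure_itv /=.
by case: ifPn => _; rewrite -?EFinB ltry.
Qed.

(** Measurability of [g] is a hypothesis of its own: almost everywhere equality does not transfer it
    for Borel sets. *)
Lemma integrable_ae_eq (f g : R -> R) : measurable_fun Om g ->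
  f = g %[ae mu in Om] -> integrable f -> integrable g.
Proof.
move=> mg fg /integrableP[mf foo]; apply/integrableP; split.
  exact/measurable_EFinP.
apply: le_lt_trans foo; rewrite le_eqVlt; apply/orP; left; apply/eqP.
apply: ae_eq_integral => //=.
- by apply/measurable_EFinP; exact: measurableT_comp.
- by apply/measurable_EFinP; apply: measurableT_comp => //; exact/measurable_EFinP.
- by apply: aeS fg => x h /h /= ->.
Qed.

Lemma eq_Rintegral_ae (f g : R -> R) : measurable_fun Om f -> measurable_fun Om g ->
  f = g %[ae mu in Om] ->
  \int[mu]_(x in Om) f x = \int[mu]_(x in Om) g x.
Proof.
move=> mf mg fg; congr fine; apply: ae_eq_integral => //.
- exact/measurable_EFinP.
- exact/measurable_EFinP.
- by apply: aeS fg => x h /h ->.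
Qed.

Lemma L2P (g : R -> R) :
  L2 L g <-> measurable_fun Om g /\ integrable (fun x => g x ^+ 2).
Proof.
have E : (fun x => (g x ^+ 2)%:E) \_ Om = EFin \o (fun x => (g \_ Om) x ^+ 2).
  apply/funext => x; rewrite /= !patchE; case: ifP => // _.
  by rewrite expr0n.
split.
- move=> h; split.
    have := sub_Lfun_mfun h; rewrite inE => m.
    exact/(measurable_restrictT _ measurable_Omega).
  rewrite integrable_mkcond// E; exact: Lfun2_integrable_sqr.
- move=> [mg]; rewrite integrable_mkcond// E => ig.
  have mg' : measurable_fun setT (g \_ Om).
    exact/(measurable_restrictT _ measurable_Omega).
  rewrite /L2 /= inE; apply/andP; split; first by rewrite inE.
  rewrite inE /= /finite_norm unlock poweR_lty//.
  move/integrableP : ig => [_]; apply: le_lt_trans.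
  rewrite le_eqVlt; apply/orP; left; apply/eqP; apply: eq_integral => x _ /=.
  by rewrite powR_mulrn ?normr_ge0 -?normrX.
Qed.

Lemma L2_measurable (g : R -> R) : L2 L g -> measurable_fun Om g.
Proof. by move/L2P => []. Qed.

Lemma L2norm_sqr (g : R -> R) : L2 L g -> L2norm L g ^+ 2 = ip g g.
Proof.
move=> h; rewrite /L2norm /ip.
have hf := h; move: hf; rewrite /L2 /= inE => /andP[_]; rewrite inE /= /finite_norm => hf.
have : ('N[mu]_2%:E[EFin \o (g \_ Om)] `^ 2 = \int[mu]_(x in Om) (g x * g x)%:E)%E.
  rewrite powR_Lnorm// [RHS]integral_mkcond; apply: eq_integral => x _.
  rewrite /= !patchE; case: ifP => _ /=; last by rewrite normr0 powR0.
  by rewrite powR_mulrn// -normrX ger0_norm ?sqr_ge0.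
have : (0 <= 'N[mu]_2%:E[EFin \o (g \_ Om)])%E by rewrite Lnorm_ge0.
move: hf; case: ('N[mu]_2%:E[EFin \o (g \_ Om)])%E => //= r _.
rewrite lee_fin => r0 E.
by rewrite /Rintegral -E /= powR_mulrn.
Qed.

Lemma L2norm_ge0 (g : R -> R) : 0 <= L2norm L g.
Proof. by rewrite fine_ge0// Lnorm_ge0. Qed.

Lemma L2_mul_integrable (g h : R -> R) : L2 L g -> L2 L h ->
  integrable (fun x => g x * h x).
Proof.
move=> /L2P[mg ig] /L2P[mh ih].
apply: (@le_integrable _ _ _ mu Om _ _ (fun x => (g x ^+ 2)%:E + (h x ^+ 2)%:E)%E) => //.
- by apply/measurable_EFinP; exact: measurable_funM.
- move=> x _ /=; rewrite lee_fin [leRHS]ger0_norm ?addr_ge0 ?sqr_ge0//.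
  rewrite normrM -(real_normK (num_real (g x))) -(real_normK (num_real (h x))).
  set a := `|g x|; set b := `|h x|.
  have : 0 <= (a - b) ^+ 2 by exact: sqr_ge0.
  have : 0 <= a * b by rewrite mulr_ge0 ?normr_ge0.
  by rewrite sqrrB; lra.
- exact: integrableD.
Qed.

Lemma L2D (g h : R -> R) : L2 L g -> L2 L h -> L2 L (fun x => g x + h x).
Proof.
move=> Lg Lh; have igh := L2_mul_integrable Lg Lh.
move/L2P: Lg => [mg ig]; move/L2P: Lh => [mh ih]; apply/L2P; split.
  exact: measurable_funD.
have -> : (fun x => ((g x + h x) ^+ 2)%:E) = (fun x => (g x ^+ 2)%:E +
    (2%:E * (g x * h x)%:E + (h x ^+ 2)%:E))%E.
  by apply/funext => x; rewrite -EFinM -!EFinD; congr EFin; ring.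
by apply: integrableD => //; apply: integrableD => //; exact: integrableZl.
Qed.

Lemma L2Z (k : R) (g : R -> R) : L2 L g -> L2 L (fun x => k * g x).
Proof.
move=> /L2P[mg ig]; apply/L2P; split; first exact: measurable_funM.
under eq_fun do rewrite exprMn EFinM.
exact: integrableZl.
Qed.

Lemma L2N (g : R -> R) : L2 L g -> L2 L (fun x => - g x).
Proof. by move/(L2Z (-1)); under eq_fun do rewrite mulN1r. Qed.

Lemma L2B (g h : R -> R) : L2 L g -> L2 L h -> L2 L (fun x => g x - h x).
Proof. by move=> Lg Lh; apply: L2D => //; exact: L2N. Qed.

Lemma L2_ae (g h : R -> R) : measurable_fun Om h -> g = h %[ae mu in Om] ->
  L2 L g -> L2 L h.
Proof.
move=> mh gh /L2P[mg ig]; apply/L2P; split => //.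
apply: integrable_ae_eq ig; first exact: measurable_funX.
by apply: aeS gh => x H /H ->.
Qed.

Lemma L2_bounded (g : R -> R) (B : R) : measurable_fun Om g ->
  (forall x, Om x -> `|g x| <= B) -> L2 L g.
Proof.
move=> mg gB; apply/L2P; split => //.
apply: (@le_integrable _ _ _ mu Om _ _ (cst (B ^+ 2)%:E)) => //.
- by apply/measurable_EFinP; exact: measurable_funX.
- move=> x Ox /=; rewrite lee_fin !ger0_norm ?sqr_ge0//.
  rewrite -(real_normK (num_real (g x))) lerXn2r ?nnegrE ?gB//.
  exact: le_trans (gB x Ox).
- apply: measurable_bounded_integrable => //; first exact: mu_Omega_lty.
  by exists (`|B ^+ 2|); split => // M /ltW BM x _; exact: le_trans BM.
Qed.

Lemma L2_ae_bounded (g : R -> R) (B : R) : 0 <= B -> measurable_fun Om g ->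
  (\forall x \ae mu, Om x -> `|g x| <= B) -> L2 L g.
Proof.
move=> B0 mg gB.
(* The truncation changes g on a null set only and makes the bound hold everywhere. *)
pose h x := if `|g x| <= B then g x else 0.
have mh : measurable_fun Om h.
  apply: measurable_fun_if => //.
  - by apply: measurable_fun_ler => //; exact: measurableT_comp.
  - by apply: measurable_funS mg.
apply: (@L2_ae h) => //.
- by apply: aeS gB => x H /H; rewrite /h => ->.
- by apply: (@L2_bounded _ B) => // x _; rewrite /h; case: ifP => //; rewrite normr0.
Qed.

Lemma L2_cst (k : R) : L2 L (cst k).
Proof. by apply: (@L2_bounded _ `|k|). Qed.

Lemma L2_integrable (g : R -> R) : L2 L g -> integrable g.
Proof.
by move=> /(L2_mul_integrable (L2_cst 1)) /=; under eq_fun do rewrite mul1r.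
Qed.

Lemma ipC (g h : R -> R) : ip g h = ip h g.
Proof. by apply: eq_Rintegral => x _; rewrite mulrC. Qed.

Lemma ipDl (f g h : R -> R) : L2 L f -> L2 L g -> L2 L h ->
  ip (fun x => f x + g x) h = ip f h + ip g h.
Proof.
move=> Lf Lg Lh; rewrite /ip -RintegralD//; try exact: L2_mul_integrable.
by apply: eq_Rintegral => x _; rewrite mulrDl.
Qed.

Lemma ipZl (k : R) (g h : R -> R) : L2 L g -> L2 L h ->
  ip (fun x => k * g x) h = k * ip g h.
Proof.
move=> Lg Lh; rewrite /ip -RintegralZl//; last exact: L2_mul_integrable.
by apply: eq_Rintegral => x _; rewrite mulrA.
Qed.

Lemma ipBl (f g h : R -> R) : L2 L f -> L2 L g -> L2 L h ->
  ip (fun x => f x - g x) h = ip f h - ip g h.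
Proof.
move=> Lf Lg Lh; rewrite /ip -RintegralB//; try exact: L2_mul_integrable.
by apply: eq_Rintegral => x _; rewrite mulrBl.
Qed.

Lemma ipDr (f g h : R -> R) : L2 L f -> L2 L g -> L2 L h ->
  ip h (fun x => f x + g x) = ip h f + ip h g.
Proof. by move=> *; rewrite ipC ipDl// ![ip _ h]ipC. Qed.

Lemma ipZr (k : R) (g h : R -> R) : L2 L g -> L2 L h ->
  ip h (fun x => k * g x) = k * ip h g.
Proof. by move=> *; rewrite ipC ipZl// [ip _ h]ipC. Qed.

Lemma ipBr (f g h : R -> R) : L2 L f -> L2 L g -> L2 L h ->
  ip h (fun x => f x - g x) = ip h f - ip h g.
Proof. by move=> *; rewrite ipC ipBl// ![ip _ h]ipC. Qed.

Lemma ip_ge0 (g : R -> R) : 0 <= ip g g.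
Proof. by apply: Rintegral_ge0 => x _; rewrite -expr2 sqr_ge0. Qed.

Lemma ip_ae (f f' g g' : R -> R) : L2 L f -> L2 L f' -> L2 L g -> L2 L g' ->
  f = f' %[ae mu in Om] -> g = g' %[ae mu in Om] -> ip f g = ip f' g'.
Proof.
move=> Lf Lf' Lg Lg' ff' gg'; apply: eq_Rintegral_ae.
- by apply: measurable_funM; exact: L2_measurable.
- by apply: measurable_funM; exact: L2_measurable.
- by apply: aeS2 ff' gg' => x hf hg Ox; rewrite hf// hg.
Qed.

Lemma ip_quad (g h : R -> R) (r : R) : L2 L g -> L2 L h ->
  0 <= ip g g + 2 * r * ip g h + r ^+ 2 * ip h h.
Proof.
move=> Lg Lh; have := ip_ge0 (fun x => g x + r * h x).
have Lrh := L2Z r Lh; have Ls := L2D Lg Lrh.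
rewrite ipDl// !ipDr// !ipZl// !ipZr// (ipC h g).
by congr (_ <= _); ring.
Qed.

Lemma ip_CS (g h : R -> R) : L2 L g -> L2 L h ->
  `|ip g h| <= L2norm L g * L2norm L h.
Proof.
move=> Lg Lh.
have := quad_disc (ip_ge0 g) (fun r => ip_quad r Lg Lh).
rewrite -!L2norm_sqr// -exprMn => -[_ H].
rewrite -(@ler_pXn2r _ 2) ?nnegrE ?mulr_ge0 ?L2norm_ge0//.
by rewrite -normrX ger0_norm ?sqr_ge0.
Qed.

End L2_theory.

(** * Plateau test functions *)

Section smooth_step.
Context {R : realType}.

Definition pospart (y : R) : R := 2^-1 * (y + `|y|).

Lemma pospart_ge0E (y : R) : 0 <= y -> pospart y = y.
Proof. by move=> y0; rewrite /pospart ger0_norm//; field. Qed.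

Lemma pospart_le0E (y : R) : y <= 0 -> pospart y = 0.
Proof. by move=> y0; rewrite /pospart ler0_norm// subrr mulr0. Qed.

Lemma continuous_pospart : continuous pospart.
Proof.
move=> x; apply: cvgM; first exact: cvg_cst.
by apply: cvgD; [exact: cvg_id|exact: norm_continuous].
Qed.

(** A quadratic bound on the error of the linear approximation treats the kink of the positive part
    like any other point. *)
Lemma is_derive_quadratic_error (f : R -> R) (x l C : R) :
  (forall h, `|f (h + x) - f x - l * h| <= C * h ^+ 2) -> is_derive x 1 f l.
Proof.
move=> H.
have cv : h^-1 *: (f (h *: 1 + x) - f x) @[h --> 0^'] --> l.
  apply/subr_cvg0; apply/norm_cvg0P.
  apply: (@squeeze_cvgr _ _ _ _ (fun=> 0) (fun h => C * `|h|)).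
  - near=> h; rewrite normr_ge0 /=.
    have h0 : h != 0 by near: h; exact: nbhs_dnbhs_neq.
    have -> : h^-1 *: (f (h *: 1 + x) - f x) - l = h^-1 * (f (h + x) - f x - l * h).
      by rewrite /GRing.scale/= mulr1; field.
    rewrite normrM normfV ler_pdivrMl ?normr_gt0//.
    apply: le_trans (H h) _.
    by rewrite -(real_normK (num_real h)) [leRHS]mulrCA -expr2.
  - exact: cvg_cst.
  - rewrite -[X in _ --> X](mulr0 C); apply: cvgM; first exact: cvg_cst.
    rewrite -[X in _ --> X](@normr0 _ R); apply: cvg_norm.
    exact: nbhs_dnbhs.
apply: DeriveDef; first by apply/cvg_ex; exists l.
exact/cvg_lim.
Unshelve. all: by end_near. Qed.

(** Squaring the positive part makes it C^1, the regularity that [test_fun] demands. *)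
Definition sqpos (y : R) : R := pospart y ^+ 2.

Lemma is_derive_sqpos (y : R) : is_derive y 1 sqpos (2 * pospart y).
Proof.
apply: (@is_derive_quadratic_error _ _ _ 1) => h; rewrite mul1r /sqpos.
have [y0|/ltW y0] := leP 0 y; have [yh|/ltW yh] := leP 0 (h + y);
  rewrite ?(pospart_ge0E y0) ?(pospart_ge0E yh) ?(pospart_le0E y0) ?(pospart_le0E yh).
- rewrite (_ : _ - _ = h ^+ 2); last by ring.
  by rewrite ger0_norm ?sqr_ge0.
- rewrite ler_norml; apply/andP; split; nra.
- rewrite ler_norml; apply/andP; split; nra.
- by rewrite expr0n/= !(mulr0, mul0r, subrr) normr0 sqr_ge0.
Qed.

Lemma sqpos_ge0 (y : R) : 0 <= sqpos y.
Proof. exact: sqr_ge0. Qed.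

Lemma sqpos_le0E (y : R) : y <= 0 -> sqpos y = 0.
Proof. by move=> y0; rewrite /sqpos pospart_le0E// expr0n. Qed.

(* Equal to 0 where n x (b - x) <= 1 and to 1 where n x (b - x) >= 2. *)
Definition plateau (b : R) (n : nat) (x : R) : R :=
  1 - sqpos (1 - sqpos (n%:R * (x * (b - x)) - 1)).

Definition dplateau (b : R) (n : nat) (x : R) : R :=
  4 * (pospart (1 - sqpos (n%:R * (x * (b - x)) - 1)) *
       (pospart (n%:R * (x * (b - x)) - 1) * (n%:R * (b - 2 * x)))).

Lemma is_derive_plateau (b : R) (n : nat) (x : R) :
  is_derive x 1 (plateau b n) (dplateau b n x).
Proof.
have h0 : is_derive x 1 (fun x => n%:R * (x * (b - x)) - 1) (n%:R * (b - 2 * x)).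
  apply: (@is_derive_quadratic_error _ _ _ n%:R) => h.
  rewrite (_ : _ - _ = - (n%:R * h ^+ 2)); last by ring.
  by rewrite normrN ger0_norm// mulr_ge0 ?sqr_ge0.
have h1 := is_derive1_comp (is_derive_sqpos _) h0.
have h2 := is_deriveDZ (-1) (is_derive_cst (1 : R) x 1) h1.
have h3 := is_derive1_comp (is_derive_sqpos _) h2.
have h4 := is_deriveDZ (-1) (is_derive_cst (1 : R) x 1) h3.
have E : (fun x0 => cst 1 x0 +
         -1 * (sqpos \o (fun x1 => cst 1 x1 +
           -1 * (sqpos \o (fun x2 : R => n%:R * (x2 * (b - x2)) - 1)) x1)) x0) = plateau b n.
  by apply/funext => y; rewrite /plateau /= !mulN1r.
rewrite -E; apply: (is_derive_eq h4); rewrite /GRing.scale /= /dplateau !mulN1r.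
ring.
Qed.

Lemma continuous_sqpos : continuous sqpos.
Proof. by move=> x; apply: cvgM; exact: continuous_pospart. Qed.

Lemma continuous_plateau (b : R) (n : nat) : continuous (plateau b n).
Proof. by move=> x; apply: continuous_of_derive (is_derive_plateau b n x). Qed.

Lemma continuous_dplateau (b : R) (n : nat) : continuous (dplateau b n).
Proof.
pose w (y : R) := n%:R * (y * (b - y)) - 1.
pose u (y : R) := 1 - (sqpos \o w) y.
have cw : continuous w.
  move=> x; apply: cvgB; last exact: cvg_cst.
  apply: cvgM; first exact: cvg_cst.
  by apply: cvgM; [exact: cvg_id|apply: cvgB; [exact: cvg_cst|exact: cvg_id]].
have cu : continuous u.
  move=> x; apply: cvgB; first exact: cvg_cst.
  by apply: continuous_comp; [exact: cw|exact: continuous_sqpos].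
have -> : dplateau b n = fun y => 4 * ((pospart \o u) y *
    ((pospart \o w) y * (n%:R * (b - 2 * y)))) by [].
move=> x; apply: cvgM; first exact: cvg_cst.
apply: cvgM; first by apply: continuous_comp; [exact: cu|exact: continuous_pospart].
apply: cvgM; first by apply: continuous_comp; [exact: cw|exact: continuous_pospart].
apply: cvgM; first exact: cvg_cst.
apply: cvgB; first exact: cvg_cst.
by apply: cvgM; [exact: cvg_cst|exact: cvg_id].
Qed.

Lemma plateau_out (b : R) (n : nat) (x : R) :
  n%:R * (x * (b - x)) <= 1 -> plateau b n x = 0.
Proof.
move=> h; rewrite /plateau [sqpos (_ - 1)]sqpos_le0E ?subr_le0//.
by rewrite subr0 /sqpos pospart_ge0E// expr1n subrr.
Qed.

Lemma plateau_in (b : R) (n : nat) (x : R) :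
  2 <= n%:R * (x * (b - x)) -> plateau b n x = 1.
Proof.
move=> h; rewrite /plateau [sqpos (1 - _)]sqpos_le0E ?subr0//.
rewrite subr_le0 /sqpos pospart_ge0E; last lra.
rewrite -(expr1n _ 2) lerXn2r ?nnegrE//; lra.
Qed.

Lemma plateau_itv (b : R) (n : nat) (x : R) : 0 <= plateau b n x <= 1.
Proof.
rewrite /plateau; set w := sqpos (_ * _ - 1); have w0 : 0 <= w by exact: sqpos_ge0.
have := sqpos_ge0 (1 - w); have [w1|/ltW w1] := leP w 1.
  rewrite /sqpos pospart_ge0E ?subr_ge0// => ?; apply/andP; split; nra.
by rewrite sqpos_le0E ?subr_le0// => _; rewrite subr0 ler01 lexx.
Qed.

Lemma plateau_support (b : R) (n : nat) : 0 < b ->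
  exists2 d : R, 0 < d & forall x, plateau b n x != 0 -> d <= x <= b - d.
Proof.
move=> b0; exists ((n%:R + 1) * b)^-1; first by rewrite invr_gt0 mulr_gt0.
move=> x; apply: contra_neqT => /negP H; apply: plateau_out.
rewrite leNgt; apply/negP => h; apply: H.
have n0 : 0 <= n%:R :> R by [].
have xb : 0 < x * (b - x).
  by rewrite ltNge; apply/negP => xb0; have := mulr_ge0_le0 n0 xb0; lra.
have h1 : 1 < (n%:R + 1) * (x * (b - x)) by rewrite mulrDl mul1r; lra.
have nb : 0 < (n%:R + 1) * b by rewrite mulr_gt0.
have [x0 bx0] : 0 < x /\ 0 < b - x.
  have [x0|x0] := ltP 0 x; first by rewrite -(pmulr_rgt0 _ x0).
  have : x * (b - x) <= 0 by apply: mulr_le0_ge0 => //; lra.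
  lra.
apply/andP; split.
- rewrite -div1r ler_pdivrMr//; apply: ltW; apply: lt_le_trans h1 _.
  rewrite mulrCA ler_wpM2l ?(ltW x0)// ler_wpM2l//; lra.
- rewrite lerBrDr -lerBrDl -div1r ler_pdivrMr//; apply: ltW; apply: lt_le_trans h1 _.
  rewrite [leLHS]mulrCA mulrA mulrC ler_wpM2l ?(ltW bx0)// mulrC ler_wpM2l//; lra.
Qed.

Lemma plateau_cvg (b x : R) : 0 < b ->
  plateau b n x @[n --> \oo] --> (\1_(`]0, b[%classic) x : R).
Proof.
move=> b0; have [xb|xb] := boolP (x \in `]0, b[%R).
- rewrite indicE mem_set//=.
  move: xb; rewrite in_itv/= => /andP[x0 xb].
  have q0 : 0 < x * (b - x) by rewrite mulr_gt0// subr_gt0.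
  apply: cvg_near_cst; near=> n; apply: plateau_in.
  rewrite -ler_pdivrMr//; near: n; exact: nbhs_infty_ger.
- rewrite indicE memNset /=; last exact/negP.
  apply: cvg_near_cst; apply: nearW => n; apply: plateau_out.
  apply: (@le_trans _ _ 0) => //; apply: mulr_ge0_le0 => //.
  move: xb; rewrite in_itv/= negb_and -!leNgt => /orP[x0|bx].
    by apply: mulr_le0_ge0 => //; rewrite subr_ge0 ltW// (le_lt_trans x0).
  by apply: mulr_ge0_le0; [exact: le_trans (ltW b0) bx|rewrite subr_le0].
Unshelve. all: by end_near. Qed.

End smooth_step.

(** * Test functions separate square integrable functions *)

Section test_functions.
Context {R : realType} (L : R).
Hypothesis L_gt0 : 0 < L.
Local Notation mu := (@lebesgue_measure R).
Local Notation Om := (Omega L).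
Local Notation integrable f := (mu.-integrable Om (fun x => (f x)%:E)).
Let mOm : measurable Om := measurable_Omega L.
Local Hint Resolve mOm : core.

Lemma test_funI (phi dphi : R -> R) (d : R) : 0 < d ->
  (forall x : R, is_derive x 1 phi (dphi x)) -> continuous dphi ->
  (forall x, phi x != 0 -> d <= x <= L - d) ->
  test_fun L phi /\ phi^`()%classic = dphi.
Proof.
move=> d0 D cd supp.
have E : phi^`()%classic = dphi.
  by apply/funext => x; rewrite derive1E; case: (D x).
have sub : closure [set x | phi x != 0] `<=` `[d, L - d].
  rewrite [X in _ `<=` X](_ : _ = closure `[d, L - d]).
    by apply: closureS => x /= /supp; rewrite in_itv.
  by apply/closure_id; exact: itv_closed.
split => //; split.
- by move=> x; case: (D x).
- by rewrite E.
- apply: subclosed_compact sub; first exact: closed_closure.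
  exact: segment_compact.
- apply: subset_trans sub _ => x /=; rewrite /Omega /= !in_itv/= => /andP[? ?].
  by apply/andP; split; lra.
Qed.

Lemma plateau_test (a b : R) (n : nat) : 0 < b -> b <= L ->
  test_fun L (fun x => a * plateau b n x).
Proof.
move=> b0 bL; have [d d0 supp] := plateau_support n b0.
have D (x : R) : is_derive x 1 (fun x => a * plateau b n x) (a * dplateau b n x).
  exact: is_deriveZl (is_derive_plateau b n x).
have cD : continuous (fun x => a * dplateau b n x).
  by move=> x; apply: cvgM; [exact: cvg_cst|exact: continuous_dplateau].
suff S x : a * plateau b n x != 0 -> d <= x <= L - d.
  by have [] := test_funI d0 D cD S.
rewrite mulf_eq0 negb_or => /andP[_] /supp /andP[-> xb] /=.
by apply: le_trans xb _; rewrite lerD2r.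
Qed.

Lemma Rintegral_dct (f_ : nat -> R -> R) (f g : R -> R) :
  (forall n, measurable_fun Om (f_ n)) -> measurable_fun Om f -> integrable g ->
  (forall x, Om x -> f_ n x @[n --> \oo] --> f x) ->
  (forall n x, Om x -> `|f_ n x| <= g x) ->
  \int[mu]_(x in Om) f_ n x @[n --> \oo] --> (\int[mu]_(x in Om) f x : R).
Proof.
move=> mf_ mf ig cf fg.
have [|||||ifo _ H] := @dominated_convergence _ _ R mu Om mOm
  (fun n x => (f_ n x)%:E) (fun x => (f x)%:E) (fun x => (g x)%:E).
- by move=> n; apply/measurable_EFinP; exact: mf_.
- by apply/measurable_EFinP; exact: mf.
- by apply: aeW => x Ox; apply: cvg_EFin; [exact: nearW|exact: cf].
- exact: ig.
- by apply: aeW => x n Ox; rewrite lee_fin fg.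
apply: fine_cvg; rewrite fineK //.
exact: integrable_fin_num.
Qed.

(** Integrating the extension by zero from -oo defines the primitive on the whole line: it vanishes
    for x <= 0 and is constant for x >= L. *)
Definition primitive (h : R -> R) (x : R) : R := \int[mu]_(y in `]-oo, x]) (h \_ Om) y.

Lemma primE (h : R -> R) (x : R) :
  primitive h x = \int[mu]_(y in Om) (h y * \1_(`]-oo, x]%classic) y).
Proof.
rewrite /primitive Rintegral_mkcond [RHS]Rintegral_mkcond.
apply: eq_Rintegral => y _; rewrite !patchE indicE.
by case: ifP => //= _; case: ifP => //= _; rewrite ?mulr1 ?mulr0.
Qed.

Lemma ae_neq (a : R) : \forall x \ae mu, x != a.
Proof.
exists [set a]; split => //; first exact: lebesgue_measure_set1.
by move=> x /= /negP; rewrite negbK => /eqP.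
Qed.

Lemma integrable_indic_mul (h : R -> R) (A : set R) : measurable A ->
  integrable h -> integrable (fun y => h y * \1_A y).
Proof.
move=> mA ih.
have mh : measurable_fun Om h by case/integrableP: ih => /measurable_EFinP.
apply: (@le_integrable _ _ _ mu Om _ _ (fun x => (h x)%:E)) => //.
  by apply/measurable_EFinP; apply: measurable_funM => //.
move=> x _ /=; rewrite lee_fin normrM ler_piMr//.
by rewrite indicE; case: (_ \in _); rewrite /= ?normr1 ?normr0.
Qed.

Lemma integrable_restr (h : R -> R) : integrable h ->
  mu.-integrable setT (EFin \o (h \_ Om)).
Proof.
rewrite integrable_mkcond//.
by rewrite restrict_EFin.
Qed.

Lemma prim_eq0_ae (h : R -> R) : integrable h ->
  (forall x, primitive h x = 0) -> h = cst 0 %[ae mu in Om].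
Proof.
move=> ih P0.
have i y : mu.-integrable `]-oo, y] (EFin \o (h \_ Om)).
  exact: integrableS (integrable_restr ih).
have li : locally_integrable setT (h \_ Om).
  exact: integrable_locally_restrict.
apply: aeS (FTC1Ny i li) => x /= [_].
rewrite (_ : (fun x => _) = cst 0); last by apply/funext => y; exact: P0.
by rewrite derive1_cst => E Ox; rewrite E patchE mem_set.
Qed.

(* The plateau functions converge to the indicator of ]0, b[, so every primitive of h
   vanishes and Lebesgue's differentiation theorem applies. *)
Lemma ae_eq0_of_plateau (h : R -> R) : L2 L h ->
  (forall b n, 0 < b -> b <= L -> \int[mu]_(x in Om) (h x * plateau b n x) = 0) ->
  h = cst 0 %[ae mu in Om].
Proof.
move=> Lh H; have ih := L2_integrable Lh; have mh := L2_measurable Lh.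
apply: prim_eq0_ae => // x; rewrite primE.
have [x0|x0] := leP x 0.
  rewrite (_ : \int[mu]_(y in _) _ = \int[mu]_(y in Om) cst 0 y).
    by rewrite Rintegral_cst// mul0r.
  apply: eq_Rintegral => y; rewrite inE /Omega /= in_itv/= => /andP[y0 _].
  rewrite indicE memNset ?mulr0//= in_itv/= => yx.
  by have := lt_le_trans y0 (le_trans yx x0); rewrite ltxx.
pose b := Num.min x L.
have b0 : 0 < b by rewrite lt_min x0.
have bL : b <= L by rewrite ge_min lexx orbT.
transitivity (\int[mu]_(y in Om) (h y * \1_(`]0, b[%classic) y)).
  apply: eq_Rintegral_ae.
  - by apply: measurable_funM.
  - by apply: measurable_funM.
  - apply: aeS (ae_neq x) => y yx; rewrite /Omega /= in_itv/= => /andP[y0 yL].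
    congr (_ * _); rewrite !indicE; congr (_ %:R); congr nat_of_bool.
    apply/idP/idP; rewrite !inE /= !in_itv/= y0 /b lt_min yL andbT /=.
      by rewrite lt_neqAle yx.
    exact: ltW.
have C : \int[mu]_(x in Om) (h x * plateau b n x) @[n --> \oo] -->
    (\int[mu]_(x in Om) (h x * \1_(`]0, b[%classic) x) : R).
  apply: (@Rintegral_dct _ _ (fun x => `|h x|)).
  - move=> n; apply: measurable_funM => //; apply: measurable_funTS.
    exact: continuous_measurable_fun (@continuous_plateau _ b n).
  - exact: measurable_funM.
  - exact: integrable_norm ih.
  - move=> y _; apply: cvgM; [exact: cvg_cst|exact: plateau_cvg].
  - move=> n y _; rewrite normrM ler_piMr//.
    by have /andP[p0 p1] := plateau_itv b n y; rewrite ger0_norm.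
have E : (fun n => \int[mu]_(x in Om) (h x * plateau b n x)) = fun=> 0.
  by apply/funext => n; exact: H.
by move: C; rewrite E => /(cvg_lim (@Rhausdorff R)) <-; rewrite lim_cst.
Qed.

End test_functions.

(** * Fubini's theorem on a triangle *)

Section fubini_triangle.
Context {R : realType}.
Local Notation mu := (@lebesgue_measure R).
Variables (F G : R -> R).
Hypothesis iF : mu.-integrable setT (EFin \o F).
Hypothesis iG : mu.-integrable setT (EFin \o G).

Let K (z : R * R) : R := if z.2 <= z.1 then F z.1 * G z.2 else 0.

Let mF : measurable_fun setT F.
Proof. by case/integrableP: iF => /measurable_EFinP. Qed.

Let mG : measurable_fun setT G.
Proof. by case/integrableP: iG => /measurable_EFinP. Qed.

Let mK : measurable_fun setT (EFin \o K).
Proof.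
apply/measurable_EFinP; apply: measurable_fun_ifT => //.
  by apply: measurable_fun_ler.
apply: measurable_funM; exact: measurableT_comp.
Qed.

Lemma integrable_if (H : R -> R) (c : R -> bool) : measurable_fun setT c ->
  mu.-integrable setT (EFin \o H) ->
  mu.-integrable setT (fun x => (if c x then H x else 0)%:E).
Proof.
move=> mc iH; have mH : measurable_fun setT H.
  by case/integrableP: iH => /measurable_EFinP.
apply: (le_integrable _ _ _ iH) => //.
  by apply/measurable_EFinP; apply: measurable_fun_ifT.
by move=> x _ /=; rewrite lee_fin; case: (c x); rewrite ?normr0.
Qed.

Let mle1 x : measurable_fun setT (fun y : R => y <= x).
Proof. by apply: measurable_fun_ler. Qed.

Let mle2 y : measurable_fun setT (fun x : R => y <= x).
Proof. by apply: measurable_fun_ler. Qed.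

Let inner1 x : (\int[mu]_y (K (x, y))%:E)%E =
  (F x * \int[mu]_y (if y <= x then G y else 0))%:E.
Proof.
rewrite EFinM fineK; last first.
  by apply: integrable_fin_num => //; exact: integrable_if.
rewrite -integralZl//; last exact: integrable_if.
apply: eq_integral => y _; rewrite /K /= -EFinM.
by case: ifP => _; rewrite ?mulr0.
Qed.

Let inner2 y : (\int[mu]_x (K (x, y))%:E)%E =
  (G y * \int[mu]_x (if y <= x then F x else 0))%:E.
Proof.
rewrite EFinM fineK; last first.
  by apply: integrable_fin_num => //; exact: integrable_if.
rewrite -integralZl//; last exact: integrable_if.
apply: eq_integral => x _; rewrite /K /= -EFinM.
by case: ifP => _; rewrite ?mulr0// mulrC.
Qed.

(** |K (x, y)| is at most |F x| |G y|, whose iterated integral factors. *)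
Let iK : (mu \x mu)%E.-integrable setT (EFin \o K).
Proof.
apply/integrable12ltyP => //.
have iF' := integrable_norm iF.
have iG' := integrable_norm iG.
apply: (@le_lt_trans _ _ (\int[mu]_x (`|F x| * \int[mu]_y `|G y|)%:E)%E).
  apply: ge0_le_integral => //.
  - by move=> x _; exact: integral_ge0.
  - have mK' : measurable_fun setT (abse \o (EFin \o K)) by exact: measurableT_comp.
    have K0 z : (0 <= (abse \o (EFin \o K)) z)%E by exact: abse_ge0.
    have := @measurable_fun_fubini_tonelli_F _ _ _ _ R mu _ mK' K0.
    exact.
  - apply/measurable_EFinP; apply: measurable_funM => //.
    exact: measurableT_comp.
  - move=> x _; rewrite EFinM [X in (_ <= _ * X)%E]fineK; last first.
      exact: integrable_fin_num.
    rewrite -integralZl//; apply: ge0_le_integral => //.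
    + by apply: measurableT_comp => //; exact: measurableT_comp mK _.
    + by apply: emeasurable_funM => //; case/integrableP: iG'.
    + move=> y _; rewrite /K /= -EFinM lee_fin.
      by case: ifP => _; rewrite ?normr0 ?mulr_ge0// normrM.
have -> : (\int[mu]_x (`|F x| * \int[mu]_y `|G y|)%:E)%E =
  (\int[mu]_x ((\int[mu]_y `|G y|)%:E * `|F x|%:E))%E.
  by apply: eq_integral => x _; rewrite -EFinM mulrC.
rewrite integralZl// -[X in (_ * X)%E]fineK ?ltry//.
exact: integrable_fin_num.
Qed.

(** Both sides are iterated integrals of F x G y over y <= x. This takes the place of integration by
    parts, for F and G that are merely integrable. *)
Lemma fubini_triangle :
  \int[mu]_x (F x * \int[mu]_y (if y <= x then G y else 0)) =
  \int[mu]_y (G y * \int[mu]_x (if y <= x then F x else 0)).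
Proof.
have := Fubini iK => /= E; congr fine.
transitivity (\int[mu]_x \int[mu]_y (K (x, y))%:E)%E.
  by apply: eq_integral => x _; rewrite -inner1.
by rewrite E; apply: eq_integral => y _; rewrite -inner2.
Qed.

End fubini_triangle.

(** * Primitives and weak derivatives *)

Section primitives.
Context {R : realType} (L : R).
Hypothesis L_gt0 : 0 < L.
Local Notation mu := (@lebesgue_measure R).
Local Notation Om := (Omega L).
Local Notation integrable f := (mu.-integrable Om (fun x => (f x)%:E)).
Local Notation prim := (primitive L).
Let mOm : measurable Om := measurable_Omega L.
Local Hint Resolve mOm : core.

Lemma Rintegral_restr (f k : R -> R) :
  \int[mu]_x ((f \_ Om) x * k x) = \int[mu]_(x in Om) (f x * k x).
Proof.
rewrite [RHS]Rintegral_mkcond; apply: eq_Rintegral => x _; rewrite !patchE.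
by case: ifP => //= _; rewrite mul0r.
Qed.

Lemma prim_ifE (h : R -> R) x :
  \int[mu]_y (if y <= x then (h \_ Om) y else 0) = prim h x.
Proof.
rewrite /primitive [RHS]Rintegral_mkcond; apply: eq_Rintegral => y _.
rewrite [RHS]patchE; case: ifPn => yx; case: ifPn => //.
- by move/negP; rewrite inE /= in_itv/= yx.
- by rewrite inE /= in_itv/= (negbTE yx).
Qed.

Lemma Rintegral_ge (f : R -> R) y : integrable f ->
  \int[mu]_x (if y <= x then (f \_ Om) x else 0) =
  \int[mu]_(x in Om) f x - prim f y.
Proof.
move=> if_.
have mf : measurable_fun Om f by case/integrableP: if_ => /measurable_EFinP.
have -> : \int[mu]_x (if y <= x then (f \_ Om) x else 0) =
    \int[mu]_(x in Om) (f x * \1_(`[y, +oo[%classic) x).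
  rewrite -Rintegral_restr; apply: eq_Rintegral => x _; rewrite indicE.
  case: ifPn => yx; first by rewrite mem_set ?mulr1//= in_itv/= yx.
  by rewrite memNset ?mulr0//= in_itv/= andbT; exact/negP.
rewrite primE; apply/eqP; rewrite eq_sym subr_eq eq_sym -RintegralD//; last 2 first.
- exact: integrable_indic_mul.
- exact: integrable_indic_mul.
apply/eqP; apply: eq_Rintegral_ae => //.
  by apply: measurable_funD; apply: measurable_funM.
(* The half-lines on the two sides of y overlap in the point y, which has measure zero. *)
apply: aeS (ae_neq y) => x xy _; rewrite -mulrDr -[RHS]mulr1; congr (_ * _).
rewrite !indicE.
have [yx|yx] := leP y x.
- rewrite mem_set ?memNset ?addr0//= in_itv/= ?yx//.
  by move=> xy'; move: xy; rewrite (@le_anti _ _ x y) ?eqxx// xy' yx.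
- rewrite memNset; last by rewrite /= in_itv/= andbT leNgt yx.
  by rewrite mem_set ?add0r//= in_itv/= ltW.
Qed.

(** Integration by parts: the second factor on the right is the integral of f from y to L. *)
Lemma fubini_prim (f h : R -> R) : integrable f -> integrable h ->
  \int[mu]_(x in Om) (f x * prim h x) =
  \int[mu]_(y in Om) (h y * (\int[mu]_(x in Om) f x - prim f y)).
Proof.
move=> if_ ih; have := fubini_triangle (integrable_restr if_) (integrable_restr ih).
under eq_Rintegral do rewrite prim_ifE.
under [in X in _ = X]eq_Rintegral do rewrite Rintegral_ge//.
by rewrite !Rintegral_restr.
Qed.

Lemma prim_continuous (h : R -> R) : integrable h ->
  {within `[0, L], continuous (prim h)}.
Proof.
move=> ih.
have ih' : mu.-integrable `[0, L] (EFin \o (h \_ Om)).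
  exact: integrableS (integrable_restr ih).
apply: subspace_eq_continuous (parameterized_integral_continuous (ltW L_gt0) ih').
move=> x; rewrite inE /= in_itv/= => /andP[x0 _].
rewrite /parameterized_integral /primitive.
rewrite /from_subspace Rintegral_mkcond [RHS]Rintegral_mkcond; apply: eq_Rintegral => y _.
rewrite !patchE.
have [yO|yO] := boolP (y \in Om); last by rewrite !if_same.
have y0 : 0 < y by move: yO; rewrite inE /Omega /= in_itv/= => /andP[].
by congr (if _ then _ else _); apply/idP/idP; rewrite !inE /= !in_itv/= (ltW y0).
Qed.

Lemma prim_measurable (h : R -> R) : integrable h -> measurable_fun Om (prim h).
Proof.
move=> ih; apply: measurable_funS (_ : measurable_fun `[0, L] _) => //.
  exact: subset_itv_oo_cc.
by apply: subspace_continuous_measurable_fun => //; exact: prim_continuous.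
Qed.

Lemma mu_Om : fine (mu Om) = L.
Proof. by rewrite /Omega lebesgue_measure_itv /= lte_fin L_gt0 /= subr0. Qed.

Lemma L2norm_le (g : R -> R) (C : R) : 0 <= C -> L2 L g ->
  (\forall x \ae mu, Om x -> `|g x| <= C) -> L2norm L g <= C * Num.sqrt L.
Proof.
move=> C0 Lg gC; rewrite -(@ler_pXn2r _ 2) ?nnegrE ?L2norm_ge0 ?mulr_ge0 ?sqrtr_ge0//.
rewrite L2norm_sqr// exprMn sqr_sqrtr ?(ltW L_gt0)//.
have mg := L2_measurable Lg.
(* The bound on g holds only almost everywhere; capping g^2 gives a function that is bounded
   everywhere and has the same integral. *)
pose h x := Num.min (g x ^+ 2) (C ^+ 2).
have mh : measurable_fun Om h by apply: measurable_minr => //; exact: measurable_funX.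
have -> : ip L g g = \int[mu]_(x in Om) h x.
  apply: eq_Rintegral_ae => //; first exact: measurable_funM.
  apply: aeS gC => x H /H gxC; rewrite /h -expr2 min_l//.
  by rewrite -(real_normK (num_real (g x))) lerXn2r ?nnegrE.
have ic : integrable (fun=> C ^+ 2) by exact: L2_integrable (L2_cst L (C ^+ 2)).
have -> : C ^+ 2 * L = \int[mu]_(x in Om) (C ^+ 2) by rewrite Rintegral_cst// mu_Om.
apply: le_Rintegral => //.
- apply: (@le_integrable _ _ _ mu Om _ _ (fun x => (C ^+ 2)%:E)) => //.
    exact/measurable_EFinP.
  move=> x _ /=; rewrite lee_fin !ger0_norm ?sqr_ge0//.
    by rewrite ge_min lexx orbT.
  by rewrite le_min !sqr_ge0.
- by move=> x _; rewrite /h ge_min lexx orbT.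
Qed.

(** Cauchy-Schwarz against the indicator of a half-line. This is the one-dimensional embedding of
    H^1 into bounded functions, by which the nonlinear sources are controlled. *)
Lemma prim_bound (h : R -> R) x : L2 L h -> `|prim h x| <= L2norm L h * Num.sqrt L.
Proof.
move=> Lh; rewrite primE -/(ip L h _).
have L1 : L2 L (\1_(`]-oo, x]%classic) : R -> R).
  apply: (@L2_bounded _ _ _ 1) => // y _.
  by rewrite indicE; case: (_ \in _); rewrite /= ?normr1 ?normr0.
apply: le_trans (ip_CS Lh L1) _; rewrite ler_wpM2l ?L2norm_ge0//.
rewrite -[leRHS]mul1r; apply: L2norm_le => //; apply: aeW => y _.
by rewrite indicE; case: (_ \in _); rewrite /= ?normr1 ?normr0.
Qed.

Lemma prim_L2 (h : R -> R) : L2 L h -> L2 L (prim h).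
Proof.
move=> Lh; apply: (@L2_bounded _ _ _ (L2norm L h * Num.sqrt L)).
  exact: prim_measurable (L2_integrable Lh).
by move=> x _; exact: prim_bound.
Qed.

Lemma plateau_L2 b n : L2 L (plateau b n).
Proof.
apply: (@L2_bounded _ _ _ 1).
  by apply: measurable_funTS; apply: continuous_measurable_fun; exact: continuous_plateau.
by move=> x _; have /andP[p0 p1] := plateau_itv b n x; rewrite ger0_norm.
Qed.

(** The integrals tend to L. The function found is the reference of nonzero mean in du
    Bois-Reymond's lemma. *)
Lemma ex_plateau_gt0 : exists n, 0 < \int[mu]_(x in Om) plateau L n x.
Proof.
have C : \int[mu]_(x in Om) plateau L n x @[n --> \oo] -->
    (\int[mu]_(x in Om) \1_(`]0, L[%classic) x : R).
  apply: (@Rintegral_dct _ _ _ _ (cst 1)).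
  - by move=> n; exact: L2_measurable (plateau_L2 L n).
  - by [].
  - exact: L2_integrable (L2_cst L 1).
  - by move=> x _; exact: plateau_cvg.
  - by move=> n x _; have /andP[p0 p1] := plateau_itv L n x; rewrite ger0_norm.
have : 0 < \int[mu]_(x in Om) (\1_(`]0, L[%classic) x : R).
  rewrite (_ : \int[mu]_(x in Om) _ = \int[mu]_(x in Om) cst 1 x).
    by rewrite Rintegral_cst// mul1r mu_Om.
  by apply: eq_Rintegral => x xO; rewrite indicE xO.
move=> /(cvgr_gt _ C) [n _ H].
by exists n; exact: (H n (leqnn n)).
Qed.

End primitives.

(** * Weak derivatives and their representation by primitives *)

Section weak_derivatives.
Context {R : realType} (L : R).
Hypothesis L_gt0 : 0 < L.
Local Notation mu := (@lebesgue_measure R).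
Local Notation Om := (Omega L).
Local Notation integrable f := (mu.-integrable Om (fun x => (f x)%:E)).
Local Notation prim := (primitive L).
Let mOm : measurable Om := measurable_Omega L.
Local Hint Resolve mOm : core.

Lemma continuous_L2 (f : R -> R) : continuous f -> L2 L f.
Proof.
move=> cf.
have cn : {within `[0, L], continuous (fun x => `|f x|)}.
  apply: continuous_subspaceT => x; apply: cvg_norm; exact: cf.
have [c _ H] := EVT_max (ltW L_gt0) cn.
apply: (@L2_bounded _ _ _ `|f c|).
  by apply: measurable_funTS; exact: continuous_measurable_fun.
move=> x xO; apply: H; exact: subset_itv_oo_cc xO.
Qed.

Lemma test_fun_out (phi : R -> R) x : test_fun L phi -> ~ Om x -> phi x = 0.
Proof.
move=> [_ _ _ sub] xO; apply: contrapT => /eqP p0; apply: xO; apply: sub.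
exact: subset_closure.
Qed.

Lemma test_fun_continuous (phi : R -> R) : test_fun L phi -> continuous phi.
Proof.
by move=> [d _ _ _] x; apply: differentiable_continuous; apply/derivable1_diffP.
Qed.

Lemma prim_derive (f df : R -> R) y : (forall x : R, is_derive x 1 f (df x)) ->
  continuous df -> 0 < y -> y <= L -> prim df y = f y - f 0.
Proof.
move=> D cdf y0 yL.
have cf : continuous f by move=> x; exact: continuous_of_derive (D x).
have Ldf := continuous_L2 cdf.
rewrite primE.
transitivity (\int[mu]_(x in Om) (df x * \1_(`]0, y[%classic) x)).
  apply: eq_Rintegral_ae.
  - by apply: measurable_funM => //; exact: L2_measurable.
  - by apply: measurable_funM => //; exact: L2_measurable.
  - apply: aeS (ae_neq y) => x xy; rewrite /Omega /= in_itv/= => /andP[x0 xL].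
    congr (_ * _); rewrite !indicE; congr (_ %:R); congr nat_of_bool.
    apply/idP/idP; rewrite !inE /= !in_itv/= x0 /=.
      by rewrite lt_neqAle xy.
    exact: ltW.
transitivity (\int[mu]_(x in `]0, y[) df x).
  rewrite Rintegral_mkcond [RHS]Rintegral_mkcond; apply: eq_Rintegral => x _.
  rewrite !patchE indicE; case: ifPn => xO.
    by case: ifP => _; rewrite ?mulr1 ?mulr0.
  case: ifPn => // xy; exfalso; move: xO; apply/negP; rewrite negbK.
  move: xy; rewrite !inE /Omega /= !in_itv/= => /andP[-> xy] /=.
  exact: lt_le_trans yL.
have icc : mu.-integrable `[0, y] (EFin \o df).
  apply: continuous_compact_integrable; first exact: segment_compact.
  exact: continuous_subspaceT.
rewrite Rintegral_itv_bndo_bndc; last first.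
  by apply: integrableS icc => //; exact: subset_itv_oo_cc.
rewrite Rintegral_itv_obnd_cbnd; last first.
  by apply: integrableS icc => //; exact: subset_itv_oc_cc.
rewrite /Rintegral (@continuous_FTC2 _ df f)//.
- exact: continuous_subspaceT.
- split.
  + by move=> x _; case: (D x).
  + by apply: cvg_at_right_filter; exact: cf.
  + by apply: cvg_at_left_filter; exact: cf.
- by move=> x _; rewrite derive1E; case: (D x).
Qed.

Lemma primL (h : R -> R) : prim h L = \int[mu]_(x in Om) h x.
Proof.
rewrite primE; apply: eq_Rintegral => x; rewrite inE /Omega /= in_itv/= => /andP[_ xL].
by rewrite indicE mem_set ?mulr1//= in_itv/= ltW.
Qed.

Lemma prim0 (h : R -> R) : prim h 0 = 0.
Proof.
rewrite primE (_ : \int[mu]_(y in _) _ = \int[mu]_(y in Om) cst 0 y).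
  by rewrite Rintegral_cst// mul0r.
apply: eq_Rintegral => x; rewrite inE /Omega /= in_itv/= => /andP[x0 _].
by rewrite indicE memNset ?mulr0//= in_itv/= leNgt x0.
Qed.

Lemma test_derive (phi : R -> R) : test_fun L phi ->
  forall x : R, is_derive x 1 phi (phi^`()%classic x).
Proof. by move=> [d _ _ _] x; apply: DeriveDef => //; rewrite derive1E. Qed.

Lemma weak_derivative_prim (c : R) (h : R -> R) : L2 L h ->
  weak_derivative L (fun x => c + prim h x) h.
Proof.
move=> Lh phi tphi; have [_ cd _ _] := tphi.
have Ld := continuous_L2 cd; have D := test_derive tphi.
have p0 : phi 0 = 0 by apply: test_fun_out => //; rewrite /Omega /= in_itv/= ltxx.
have pL : phi L = 0 by apply: test_fun_out => //; rewrite /Omega /= in_itv/= ltxx andbF.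
(* As phi vanishes at both ends, its derivative has mean zero; this removes the constant c and the
   boundary term of [fubini_prim]. *)
have I0 : \int[mu]_(x in Om) phi^`()%classic x = 0.
  by rewrite -primL (prim_derive D)// pL p0 subrr.
have Lp := prim_L2 L_gt0 Lh.
transitivity (\int[mu]_(x in Om) (c * phi^`()%classic x + phi^`()%classic x * prim h x)).
  by apply: eq_Rintegral => x _; rewrite mulrDl [prim h x * _]mulrC.
rewrite RintegralD//; last 2 first.
- exact: L2_integrable (L2Z c Ld).
- exact: L2_mul_integrable.
rewrite RintegralZl//; last exact: L2_integrable.
rewrite I0 mulr0 add0r (fubini_prim (L2_integrable Ld) (L2_integrable Lh)) I0.
rewrite -mulN1r -RintegralZl//; last first.
  by apply: L2_mul_integrable => //; exact: continuous_L2 (test_fun_continuous tphi).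
apply: eq_Rintegral => x; rewrite inE /Omega /= in_itv/= => /andP[x0 xL].
by rewrite (prim_derive D)// ?ltW// p0 subr0 sub0r mulrN mulN1r.
Qed.

(* du Bois-Reymond's lemma. *)
Lemma const_of_test (u : R -> R) : L2 L u ->
  (forall phi, test_fun L phi -> \int[mu]_(x in Om) (u x * phi^`()%classic x) = 0) ->
  exists c, u = cst c %[ae mu in Om].
Proof.
move=> Lu H; have [n0 I0] := ex_plateau_gt0 L_gt0.
set J := \int[mu]_(x in Om) plateau L n0 x in I0.
(* The only possible constant: the mean of u weighted by the reference plateau. *)
exists (ip L u (plateau L n0) / J); set c := _ / J.
suff E : (fun x => u x - c) = cst 0 %[ae mu in Om].
  by apply: aeS E => x E /E /eqP; rewrite subr_eq0 => /eqP.
have Lp b n : L2 L (plateau b n) := plateau_L2 L b n.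
apply: ae_eq0_of_plateau => //; first by apply: L2B => //; exact: L2_cst.
move=> b n b0 bL; rewrite -/(ip L _ (plateau b n)) ipBl//; last exact: L2_cst.
(* Subtracting this multiple of the reference plateau makes the mean of [th] zero, so the primitive
   of [th] has compact support and is itself a test function. *)
pose k := (\int[mu]_(x in Om) plateau b n x) / J.
pose th x := plateau b n x - k * plateau L n0 x.
have cth : continuous th.
  move=> x; apply: cvgB; first exact: continuous_plateau.
  by apply: cvgM; [exact: cvg_cst|exact: continuous_plateau].
have Lth : L2 L th by exact: continuous_L2.
have Ith : \int[mu]_(x in Om) th x = 0.
  rewrite RintegralB//; last 2 first.
  - exact: L2_integrable.
  - exact: L2_integrable (L2Z _ (Lp _ _)).
  rewrite RintegralZl//; last exact: L2_integrable.
  by rewrite -/J /k divfK ?subrr// gt_eqF.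
have [d1 d10 s1] := plateau_support n b0.
have [d2 d20 s2] := plateau_support n0 L_gt0.
pose d := Num.min d1 d2.
have d0 : 0 < d by rewrite lt_min d10.
have thS x : th x != 0 -> d <= x <= L - d.
  move=> th0; have : plateau b n x != 0 \/ plateau L n0 x != 0.
    have [p1|p1] := eqVneq (plateau b n x) 0; last by left.
    have [p2|p2] := eqVneq (plateau L n0 x) 0; last by right.
    by move: th0; rewrite /th p1 p2 mulr0 subrr eqxx.
  have hd1 : d <= d1 by rewrite ge_min lexx.
  have hd2 : d <= d2 by rewrite ge_min lexx orbT.
  case=> [/s1|/s2] /andP[h1 h2]; apply/andP; split; lra.
have thE : th \_ Om = th.
  apply/funext => x; rewrite patchE; case: ifPn => // xO.
  apply/esym/eqP; apply: contraNT xO => /thS /andP[h1 h2].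
  by rewrite inE /Omega /= in_itv/=; apply/andP; split; lra.
have D (x : R) : is_derive x 1 (prim th) (th x).
  have ith : mu.-integrable `]-oo, (x + 1)] (EFin \o th).
    by rewrite -thE; exact: integrableS (integrable_restr (L2_integrable Lth)).
  have xu : x < x + 1 by rewrite ltrDl.
  have [|dth E] := @continuous_FTC1 _ th -oo%O x (x + 1) xu ith _ (cth x).
    by rewrite ltNyr.
  have primth : prim th = fun x => \int[mu]_(t in `]-oo, x]) th t.
    by apply/funext => y; rewrite /primitive thE.
  by rewrite primth; apply: DeriveDef; [exact: dth|rewrite -derive1E].
(* Left of d nothing has been integrated yet; right of L - d all of [th] has, and its mean is
   zero. *)
have S x : prim th x != 0 -> d <= x <= L - d.
  apply: contra_neqT; rewrite negb_and -!ltNge => /orP[xd|xd].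
  - rewrite /primitive thE (_ : \int[mu]_(y in _) _ = \int[mu]_(y in `]-oo, x]) cst 0 y).
      by rewrite Rintegral_cst// mul0r.
    apply: eq_Rintegral => y; rewrite inE /= in_itv/= => yx.
    by apply/eqP; apply: contraTT xd => /thS /andP[dy _]; rewrite -leNgt (le_trans dy).
  - rewrite -[RHS]Ith primE; apply: eq_Rintegral => y _.
    have [ty|/thS /andP[_ yd]] := eqVneq (th y) 0; first by rewrite ty mul0r.
    by rewrite indicE mem_set ?mulr1//= in_itv/= (le_trans yd)// ltW.
have [tp E] := test_funI d0 D cth S.
have := H _ tp; rewrite E -/(ip L u th) ipBr//; last exact: L2Z.
rewrite ipZr// => /eqP; rewrite subr_eq0 => /eqP ->.
rewrite /ip RintegralZl//; last exact: L2_integrable.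
by rewrite /k /c /ip; ring.
Qed.

Lemma weak_derivative_rep (g h : R -> R) : L2 L g -> L2 L h ->
  weak_derivative L g h -> exists c, g = (fun x => c + prim h x) %[ae mu in Om].
Proof.
move=> Lg Lh W; have Lp := prim_L2 L_gt0 Lh.
have [|c E] := @const_of_test (fun x => g x - prim h x) (L2B Lg Lp).
  move=> phi tphi; have [_ cd _ _] := tphi; have Ld := continuous_L2 cd.
  rewrite -/(ip L _ _) ipBl// /ip W//.
  have := weak_derivative_prim 0 Lh tphi; under eq_Rintegral do rewrite add0r.
  by move=> ->; rewrite subrr.
exists c; apply: aeS E => x E /E /eqP; rewrite subr_eq => /eqP ->.
by rewrite addrC.
Qed.

Lemma weak_derivative_unique (g h1 h2 : R -> R) : L2 L h1 -> L2 L h2 ->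
  weak_derivative L g h1 -> weak_derivative L g h2 -> h1 = h2 %[ae mu in Om].
Proof.
move=> Lh1 Lh2 W1 W2.
suff E : (fun x => h1 x - h2 x) = cst 0 %[ae mu in Om].
  by apply: aeS E => x E /E /eqP; rewrite subr_eq0 => /eqP.
apply: ae_eq0_of_plateau => //; first exact: L2B.
move=> b n b0 bL; have Lp := plateau_L2 L b n.
rewrite -/(ip L _ _) ipBl//; apply/eqP; rewrite subr_eq0; apply/eqP.
have tp := plateau_test 1 n b0 bL.
have := W1 _ tp; rewrite (W2 _ tp) => /oppr_inj.
under eq_Rintegral do rewrite mul1r.
by under [in X in _ = X]eq_Rintegral do rewrite mul1r.
Qed.

End weak_derivatives.

(** * Continuous representatives, boundary values and integration by parts *)

Section boundary_values.
Context {R : realType} (L : R).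
Hypothesis L_gt0 : 0 < L.
Local Notation mu := (@lebesgue_measure R).
Local Notation Om := (Omega L).
Local Notation prim := (primitive L).
Local Notation dx := (wderiv L).
Let mOm : measurable Om := measurable_Omega L.
Local Hint Resolve mOm : core.

Lemma wderivP (g : R -> R) : H1 L g -> L2 L (dx g) /\ weak_derivative L g (dx g).
Proof.
by move=> [_ [h Lh W]];
  apply: (xgetPex (cst 0) (P := [set h | L2 L h /\ weak_derivative L g h])); exists h.
Qed.

Lemma wderiv_L2 (g : R -> R) : H1 L g -> L2 L (dx g).
Proof. by move/wderivP => []. Qed.

Lemma wderiv_ae (g h : R -> R) : H1 L g -> L2 L h -> weak_derivative L g h ->
  dx g = h %[ae mu in Om].
Proof. by move=> /wderivP[L1 W1] Lh W; exact: weak_derivative_unique W1 W. Qed.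

Lemma weak_derivativeDZ (k : R) (g h dg dh : R -> R) :
  L2 L g -> L2 L h -> L2 L dg -> L2 L dh ->
  weak_derivative L g dg -> weak_derivative L h dh ->
  weak_derivative L (fun x => g x + k * h x) (fun x => dg x + k * dh x).
Proof.
move=> Lg Lh Ldg Ldh Wg Wh phi tphi.
have [_ cd _ _] := tphi; have Ld := continuous_L2 L_gt0 cd.
have Lphi := continuous_L2 L_gt0 (test_fun_continuous tphi).
have := Wg _ tphi; have := Wh _ tphi; rewrite -!/(ip L _ _).
rewrite !ipDl ?ipZl//; try exact: L2Z.
by move=> -> ->; rewrite mulrN opprD.
Qed.

Lemma H1DZ (k : R) (g h : R -> R) : H1 L g -> H1 L h ->
  H1 L (fun x => g x + k * h x) /\
  dx (fun x => g x + k * h x) = (fun x => dx g x + k * dx h x) %[ae mu in Om].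
Proof.
move=> Hg Hh; have [Ldg Wg] := wderivP Hg; have [Ldh Wh] := wderivP Hh.
have Lg := Hg.1; have Lh := Hh.1.
have W := weak_derivativeDZ k Lg Lh Ldg Ldh Wg Wh.
have Ls : L2 L (fun x => dx g x + k * dx h x) by apply: L2D => //; exact: L2Z.
have HH : H1 L (fun x => g x + k * h x).
  split; first by apply: L2D => //; exact: L2Z.
  by exists (fun x => dx g x + k * dx h x).
by split => //; exact: wderiv_ae.
Qed.

(** Functions equal almost everywhere have the same set of weak derivatives, so [xget] picks the
    same element: an equality of functions, good for rewriting. *)
Lemma wderiv_ext (g h : R -> R) : L2 L g -> L2 L h -> g = h %[ae mu in Om] ->
  dx g = dx h.
Proof.
move=> Lg Lh gh; rewrite /wderiv; congr xget; apply/seteqP; split => f [Lf W].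
  split => // phi tphi; rewrite -W//; have [_ cd _ _] := tphi.
  have Ld := continuous_L2 L_gt0 cd.
  apply: (ip_ae Lh Lg Ld Ld) => //; last exact: aeW.
  by apply: aeS gh => x E /E.
split => // phi tphi; rewrite -W//; have [_ cd _ _] := tphi.
have Ld := continuous_L2 L_gt0 cd.
by apply: (ip_ae Lg Lh Ld Ld) => //; exact: aeW.
Qed.

Lemma ae_itv_ex (P : R -> Prop) (a b : R) : a < b -> (\forall x \ae mu, P x) ->
  exists2 x, a < x < b & P x.
Proof.
move=> ab [N [mN N0 sub]]; apply: contrapT => H.
have : (mu `]a, b[%classic <= mu N)%E.
  apply: le_measure; rewrite ?inE//.
  move=> x /=; rewrite in_itv/= => xab; apply: sub => /= Px.
  by apply: H; exists x.
rewrite N0 lebesgue_measure_itv/= lte_fin ab -EFinB lee_fin subr_le0 leNgt.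
by rewrite ab.
Qed.

Lemma continuous_ae_eq (h1 h2 : R -> R) : {within `[0, L], continuous h1} ->
  {within `[0, L], continuous h2} -> h1 = h2 %[ae mu in Om] ->
  forall x, 0 <= x <= L -> h1 x = h2 x.
Proof.
move=> c1 c2 E x xL; apply/eqP; rewrite -subr_eq0; apply: contrapT => /negP n0.
have xI : `[0, L]%classic x by rewrite /= in_itv.
have ck : (fun y => h1 y - h2 y) @ within `[0, L] (nbhs x) --> h1 x - h2 x.
  apply: cvgB; first exact: (subspace_continuousP _ _).1 c1 _ xI.
  exact: (subspace_continuousP _ _).1 c2 _ xI.
have : \forall y \near within `[0, L] (nbhs x), h1 y - h2 y != 0.
  exact: (cvgr_neq0 _ ck n0).
rewrite near_withinE => -[e /= e0 H].
have /andP[x0 xL'] := xL.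
(* Even if x is an endpoint, its neighbourhood cuts out a nonempty open interval of []0, L[], which
   meets every set of full measure. *)
have lt : Num.max 0 (x - e) < Num.min L (x + e).
  by rewrite gt_max !lt_min L_gt0 /=; apply/and3P; split => //; lra.
have [y /andP[]] := ae_itv_ex lt E.
rewrite gt_max lt_min => /andP[y0 yxe] /andP[yL yxe'] Ey.
have yO : Om y by rewrite /Omega /= in_itv/= y0.
have : h1 y - h2 y != 0.
  apply: H; last by rewrite /= in_itv/= !ltW.
  by rewrite /ball_ /= ltr_norml; apply/andP; split; lra.
by rewrite Ey// subrr eqxx.
Qed.

(** [weak_derivative_rep] exhibits a continuous representative, so the choice in [crep] does not
    fall back on its default; continuity then carries the formula from almost every point to the
    endpoints. *)
Lemma H1_crep (g : R -> R) : H1 L g ->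
  (forall x, 0 <= x <= L -> crep L g x = crep L g 0 + prim (dx g) x) /\
  g = crep L g %[ae mu in Om].
Proof.
move=> Hg; have [Ldg Wg] := wderivP Hg.
have [c E] := weak_derivative_rep L_gt0 Hg.1 Ldg Wg.
have cp : {within `[0, L], continuous (fun x => c + prim (dx g) x)}.
  move=> x; apply: cvgD; first exact: cvg_cst.
  exact: (prim_continuous L_gt0 (L2_integrable Ldg)).
have [cc cE] : {within `[0, L], continuous (crep L g)} /\ crep L g = g %[ae mu in Om].
  apply: (xgetPex (cst 0) (P := [set h | {within `[0, L], continuous h} /\ h = g %[ae mu in Om]])).
  exists (fun x => c + prim (dx g) x); split => //.
  by apply: aeS E => x H /H ->.
have EE : crep L g = (fun x => c + prim (dx g) x) %[ae mu in Om].
  by apply: aeS2 cE E => x h1 h2 xO; rewrite h1// h2.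
have crE := continuous_ae_eq cc cp EE.
split; last by apply: aeS cE => x H /H.
move=> x xL; rewrite crE// crE ?prim0 ?addr0//.
by rewrite lexx ltW.
Qed.

Lemma H1star_prim (g : R -> R) : H1star L g -> g = prim (dx g) %[ae mu in Om].
Proof.
move=> [Hg g0]; have [crE cE] := H1_crep Hg.
apply: aeS cE => x H xO; rewrite H// crE ?g0 ?add0r//.
by move: xO; rewrite /Omega /= in_itv/= => /andP[? ?]; rewrite !ltW.
Qed.

Lemma H1star_bound (g : R -> R) : H1star L g ->
  \forall x \ae mu, Om x -> `|g x| <= L2norm L (dx g) * Num.sqrt L.
Proof.
move=> Hg; apply: aeS (H1star_prim Hg) => x H xO; rewrite H//.
by apply: prim_bound => //; exact: wderiv_L2 Hg.1.
Qed.

(** Since w vanishes at L and z at 0, w is a primitive taken backwards from L and z one taken from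
    0; exchanging them on the triangle leaves no boundary term. *)
Lemma ip_wderiv (w z : R -> R) : H1 L w -> crep L w L = 0 -> H1star L z ->
  ip L w (dx z) = - ip L (dx w) z.
Proof.
move=> Hw wL Hz; have [crE cE] := H1_crep Hw.
have Ldw := wderiv_L2 Hw; have Ldz := wderiv_L2 Hz.1.
have LL : 0 <= L <= L by rewrite lexx ltW.
have w0 : crep L w 0 = - \int[mu]_(x in Om) dx w x.
  by move: (crE L LL); rewrite wL primL => /eqP; rewrite eq_sym addr_eq0 => /eqP.
rewrite (ip_ae Ldw Ldw Hz.1.1 (prim_L2 L_gt0 Ldz)); last 2 first.
- exact: aeW.
- exact: H1star_prim.
rewrite /ip (fubini_prim (L2_integrable Ldw) (L2_integrable Ldz)).
have Lr : L2 L (fun y => \int[mu]_(x in Om) dx w x - prim (dx w) y).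
  by apply: L2B; [exact: L2_cst|exact: prim_L2].
rewrite -[X in _ = - X]/(ip L _ _) -mulN1r -ipZr//.
rewrite [RHS]ipC; apply: ip_ae => //; first exact: Hw.1.
- exact: L2Z.
- apply: aeS cE => x H xO; rewrite H// crE ?w0.
    by rewrite mulN1r opprB addrC.
  by move: xO; rewrite /Omega /= in_itv/= => /andP[? ?]; rewrite !ltW.
- exact: aeW.
Qed.

Lemma test_H10 (phi : R -> R) : test_fun L phi -> H10 L phi.
Proof.
move=> tphi; have [_ cd _ _] := tphi; have D := test_derive tphi.
have Ld := continuous_L2 L_gt0 cd.
have Lphi := continuous_L2 L_gt0 (test_fun_continuous tphi).
split.
  split => //; exists (phi^`()%classic) => // psi tpsi.
  have E : phi = (fun x => 0 + prim (phi^`()%classic) x) %[ae mu in Om].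
    apply: aeW => x; rewrite /Omega /= in_itv/= => /andP[x0 xL].
    rewrite (prim_derive L_gt0 D)// ?ltW// (@test_fun_out _ _ _ 0 tphi) ?subr0 ?add0r//.
    by rewrite /Omega /= in_itv/= ltxx.
  have [_ cdpsi _ _] := tpsi; have Ldpsi := continuous_L2 L_gt0 cdpsi.
  rewrite -(weak_derivative_prim L_gt0 0 Ld tpsi).
  apply: ip_ae => //; last exact: aeW.
  by apply: L2D; [exact: L2_cst|exact: prim_L2].
(* phi approximates itself. As [wderiv] is a choice, that the H^1 norm of 0 vanishes goes through
   uniqueness of the weak derivative. *)
move=> e e0; exists phi => //.
have -> : (fun x => phi x - phi x) = cst 0 by apply/funext => x; rewrite subrr.
have L0 : L2 L (cst 0 : R -> R) := L2_cst L 0.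
have n0 : L2norm L (cst 0) = 0.
  apply/eqP; rewrite -sqrf_eq0 L2norm_sqr// /ip.
  by under eq_Rintegral do rewrite mul0r; rewrite Rintegral_cst// mul0r.
have W0 : weak_derivative L (cst 0) (cst 0).
  move=> psi tpsi; under eq_Rintegral do rewrite mul0r.
  under [in RHS]eq_Rintegral do rewrite mul0r.
  by rewrite Rintegral_cst// mul0r oppr0.
have H0 : H1 L (cst 0) by split => //; exists (cst 0).
have d0 : L2norm L (dx (cst 0)) = 0.
  have Ld0 := wderiv_L2 H0.
  apply/eqP; rewrite -sqrf_eq0 L2norm_sqr//.
  rewrite (ip_ae Ld0 L0 Ld0 L0); try exact: wderiv_ae.
  by rewrite -L2norm_sqr// n0 expr0n.
by rewrite /H1norm n0 d0 expr0n /= addr0 sqrtr0.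
Qed.

End boundary_values.

(** * Limits in L2 and the source terms *)

(** Only the base point is confined to the box; the perturbed point may leave it, which is more than
    uniform continuity on the box says. *)
Lemma uniform_cont_box (R : realType) (f : R -> R -> R) (B e : R) :
  continuous (fun z : R * R => f z.1 z.2) -> 0 < e ->
  exists2 d, 0 < d & forall b c b' c', `|b| <= B -> `|c| <= B ->
    `|b' - b| <= d -> `|c' - c| <= d -> `|f b' c' - f b c| <= e.
Proof.
move=> cf e0.
pose K : set (R * R) := `[- B, B]%classic `*` `[- B, B]%classic.
have cK : compact K by apply: compact_setX; exact: segment_compact.
pose P (d : R) (z : R * R) := forall b' c', `|b' - z.1| <= d -> `|c' - z.2| <= d ->
  `|f b' c' - f z.1 z.2| <= e.
have H : \forall d \near (0 : R)^'+, K `<=` P d.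
  apply: ((compact_near_coveringP K).1 cK) => z _.
  have e2 : 0 < e / 2 by rewrite divr_gt0.
  have Hz : \forall w \near z, `|f z.1 z.2 - f w.1 w.2| <= e / 2.
    by move/cvgrPdist_le : (cf z); apply.
  have [r /= r0 Hr] := (nbhs_ballP z _).1 Hz.
  have r2 : 0 < r / 2 by rewrite divr_gt0.
  (* Half the radius keeps both the base point and its perturbation within r of z. *)
  exists (ball z (r / 2), [set d : R | d < r / 2]) => /=.
    split; first exact: nbhsx_ballx.
    exact: nbhs_right_lt.
  move=> [[b c] d] /= [[/= zb zc] dr] b' c' hb hc.
  rewrite (_ : f b' c' - f b c = (f z.1 z.2 - f b c) - (f z.1 z.2 - f b' c')); last by ring.
  apply: le_trans (ler_normB _ _) _; rewrite [leRHS]splitr; apply: lerD.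
    apply: (Hr (b, c)); split => /=; apply: le_ball zb || apply: le_ball zc; lra.
  apply: (Hr (b', c')); split => /=.
    rewrite /ball /= (_ : z.1 - b' = (z.1 - b) - (b' - b)); last by ring.
    apply: le_lt_trans (ler_normB _ _) _; move: zb; rewrite /ball /= => zb.
    by rewrite [ltRHS]splitr; apply: ltrD => //; exact: le_lt_trans dr.
  rewrite /ball /= (_ : z.2 - c' = (z.2 - c) - (c' - c)); last by ring.
  apply: le_lt_trans (ler_normB _ _) _; move: zc; rewrite /ball /= => zc.
  by rewrite [ltRHS]splitr; apply: ltrD => //; exact: le_lt_trans dr.
have : \forall d \near (0 : R)^'+, 0 < d /\ K `<=` P d.
  by apply: filterI; [exact: nbhs_right_gt|exact: H].
move=> /(@filter_ex _ _ _)[d [d0 Hd]]; exists d => // b c b' c' hb hc.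
by apply: (Hd (b, c)); split => /=; rewrite in_itv /= -ler_norml.
Qed.

Section L2_limits.
Context {R : realType} (L : R).
Hypothesis L_gt0 : 0 < L.
Local Notation mu := (@lebesgue_measure R).
Local Notation Om := (Omega L).
Let mOm : measurable Om := measurable_Omega L.
Local Hint Resolve mOm : core.

Lemma L2norm_ae (g h : R -> R) : L2 L g -> L2 L h -> g = h %[ae mu in Om] ->
  L2norm L g = L2norm L h.
Proof.
move=> Lg Lh gh; apply/eqP; rewrite -(@eqrXn2 _ 2) ?L2norm_ge0// !L2norm_sqr//.
by apply/eqP; exact: ip_ae.
Qed.

(** The filter is arbitrary so as to serve continuity on the closed half-line of times as well as
    difference quotients, where the base time is removed. *)
Lemma ip_cvg (T : Type) (F : set_system T) (FF : Filter F)
    (a b : T -> R -> R) (a0 b0 : R -> R) :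
  (\forall s \near F, L2 L (a s)) -> (\forall s \near F, L2 L (b s)) ->
  L2 L a0 -> L2 L b0 ->
  L2norm L (fun x => a s x - a0 x) @[s --> F] --> (0 : R) ->
  L2norm L (fun x => b s x - b0 x) @[s --> F] --> (0 : R) ->
  ip L (a s) (b s) @[s --> F] --> ip L a0 b0.
Proof.
move=> La Lb La0 Lb0 ca cb; apply/subr_cvg0/norm_cvg0P.
pose m s := L2norm L (fun x => a s x - a0 x).
pose n s := L2norm L (fun x => b s x - b0 x).
apply: (@squeeze_cvgr _ _ _ _ (fun=> 0)
  (fun s => m s * n s + L2norm L a0 * n s + m s * L2norm L b0)).
- near=> s.
  have Las : L2 L (a s) by near: s.
  have Lbs : L2 L (b s) by near: s.
  have Lda : L2 L (fun x => a s x - a0 x) by exact: L2B.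
  have Ldb : L2 L (fun x => b s x - b0 x) by exact: L2B.
  rewrite normr_ge0 /=.
  have -> : ip L (a s) (b s) - ip L a0 b0 =
     ip L (fun x => a s x - a0 x) (fun x => b s x - b0 x) +
     ip L a0 (fun x => b s x - b0 x) + ip L (fun x => a s x - a0 x) b0.
    by rewrite !ipBl// !ipBr//; ring.
  apply: le_trans (ler_normD _ _) _; apply: lerD; last exact: ip_CS.
  by apply: le_trans (ler_normD _ _) _; apply: lerD; exact: ip_CS.
- exact: cvg_cst.
- rewrite (_ : 0 = 0 * 0 + L2norm L a0 * 0 + 0 * L2norm L b0); last by ring.
  apply: cvgD; first apply: cvgD.
  + exact: cvgM.
  + by apply: cvgM => //; exact: cvg_cst.
  + by apply: cvgM => //; exact: cvg_cst.
Unshelve. all: by end_near. Qed.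

(** The value f b c on the diagonal makes the factorisation [diffqE] hold without exception. *)
Definition diffq (f : R -> R -> R) (I : R -> R -> R) (a b c : R) : R :=
  if a == b then f b c else (I a c - I b c) / (a - b).

Lemma diffqE f I (a b c : R) : I a c - I b c = diffq f I a b c * (a - b).
Proof.
rewrite /diffq; case: eqVneq => [->|ab]; first by rewrite !subrr mulr0.
by rewrite divfK// subr_eq0.
Qed.

(** By the mean value theorem the quotient is a value of f at an intermediate point, so its
    convergence reduces to uniform continuity of f. *)
Lemma diffq_mvt f I (a b c : R) :
  (forall v p : R, is_derive v 1 (fun v' => I v' p) (f v p)) ->
  exists2 xi, `|xi - b| <= `|a - b| & diffq f I a b c = f xi c.
Proof.
move=> D; rewrite /diffq; case: eqVneq => [->|ab].
  by exists b => //; rewrite !subrr.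
have cI : continuous (fun v => I v c) by move=> x; exact: continuous_of_derive (D x c).
have [lt|lt|eq] := ltgtP a b; last by rewrite eq eqxx in ab.
  have [xi] := @MVT _ (fun v => I v c) (fun v => f v c) a b lt (fun x _ => D x c)
    (@continuous_subspaceT _ _ _ _ cI).
  rewrite in_itv/= => /andP[x1 x2] E.
  exists xi; first by rewrite !ltr0_norm ?subr_lt0//; lra.
  by rewrite -opprB E -[a - b]opprB invrN mulrNN mulfK// subr_eq0 gt_eqF.
have [xi] := @MVT _ (fun v => I v c) (fun v => f v c) b a lt (fun x _ => D x c)
  (@continuous_subspaceT _ _ _ _ cI).
rewrite in_itv/= => /andP[x1 x2] E.
exists xi; first by rewrite !gtr0_norm ?subr_gt0//; lra.
by rewrite E mulfK// subr_eq0 gt_eqF.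
Qed.

End L2_limits.

(** The open set where f exceeds a is a countable union of squares with rational centre and size,
    and each square pulls back to an intersection of two measurable sets. *)
Lemma measurable_fun_comp2 d (T : measurableType d) (R : realType) (D : set T)
    (f : R -> R -> R) (g h : T -> R) :
  continuous (fun z : R * R => f z.1 z.2) ->
  measurable_fun D g -> measurable_fun D h ->
  measurable_fun D (fun x => f (g x) (h x)).
Proof.
move=> cf mg mh mD; apply: (measurability _ (RGenOInfty.measurableE R)) => //.
move=> /= _ [_ [a ->] <-]; rewrite preimage_itvoy.
pose J (q1 q2 e : rat) : set T := if `[< forall u w : R, `|u - ratr q1| < ratr e ->
    `|w - ratr q2| < ratr e -> a < f u w >]
  then (D `&` [set x | `|g x - ratr q1| < ratr e]) `&`
       (D `&` [set x | `|h x - ratr q2| < ratr e]) else set0.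
have mn (k : T -> R) (q e : rat) : measurable_fun D k ->
    measurable (D `&` [set x | `|k x - ratr q| < ratr e]).
  move=> mk.
  have : measurable_fun D (fun x => `|k x - ratr q|).
    by apply: measurableT_comp => //; exact: measurable_funB.
  by move=> /(_ mD _ (measurable_itv `]-oo, (ratr e)[)); rewrite preimage_itvNyo.
rewrite [X in measurable X](_ : _ = \bigcup_(q1 : rat) \bigcup_(q2 : rat)
    \bigcup_(e : rat) J q1 q2 e).
  apply: bigcupT_measurable_rat => q1; apply: bigcupT_measurable_rat => q2.
  apply: bigcupT_measurable_rat => e; rewrite /J; case: ifP => // _.
  by apply: measurableI; exact: mn.
apply/seteqP; split => x /=.
  move=> [Dx afx].
  have Hz : \forall w \near (g x, h x), a < f w.1 w.2.
    exact: (cvgr_gt _ (cf (g x, h x)) _ afx).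
  have [r /= r0 Hr] := (nbhs_ballP (g x, h x) _).1 Hz.
  (* A centre within e of the point and a half-side e < r / 2 keep the square inside the ball of
     radius r. *)
  have r3 : 0 < r / 2 by rewrite divr_gt0.
  have [e /[!in_itv]/= /andP[e0 er]] := rat_in_itvoo r3.
  have [q1 /[!in_itv]/= /andP[q11 q12]] : exists q : rat, ratr q \in `](g x - ratr e), (g x + ratr e)[%R.
    have [|q qP] := @rat_in_itvoo R (g x - ratr e) (g x + ratr e); first lra.
    by exists q.
  have [q2 /[!in_itv]/= /andP[q21 q22]] : exists q : rat, ratr q \in `](h x - ratr e), (h x + ratr e)[%R.
    have [|q qP] := @rat_in_itvoo R (h x - ratr e) (h x + ratr e); first lra.
    by exists q.
  exists q1 => //; exists q2 => //; exists e => //; rewrite /J; case: ifPn.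
    by move=> _; split; split => //=; rewrite ltr_norml; apply/andP; split; lra.
  move=> /asboolP; apply: contra_notP => _ u w.
  rewrite !ltr_norml => /andP[u1 u2] /andP[w1 w2].
  by apply: (Hr (u, w)); split; rewrite /ball /= ltr_norml; apply/andP; split; lra.
move=> [q1 _ [q2 _ [e _]]]; rewrite /J; case: ifPn => // /asboolP H.
by move=> -[[Dx g1] [_ h1]]; split => //; exact: H.
Qed.

Lemma measurable_invr (R : realType) : measurable_fun setT (@GRing.inv R).
Proof.
have -> : @GRing.inv R = fun x => if x == 0 then 0 else x^-1.
  by apply/funext => x; case: eqVneq => // ->; rewrite invr0.
apply: measurable_fun_if => //; first exact: measurable_fun_eqr.
have -> : setT `&` (eq_op^~ 0 @^-1` [set false]) = [set x : R | x != 0].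
  by apply/seteqP; split => x /=; [move=> [_ ->]|move=> /negbTE].
apply: open_continuous_measurable_fun; first exact: open_neq.
by move=> x; rewrite inE /= => x0; exact: inv_continuous.
Qed.

(** * Convergence of the difference quotients of the source potential *)

Section source.
Context {R : realType} (L : R).
Hypothesis L_gt0 : 0 < L.
Local Notation mu := (@lebesgue_measure R).
Local Notation Om := (Omega L).
Let mOm : measurable Om := measurable_Omega L.
Local Hint Resolve mOm : core.

Lemma continuous_comp2_L2 (f : R -> R -> R) (v p : R -> R) (B : R) :
  continuous (fun z : R * R => f z.1 z.2) ->
  measurable_fun Om v -> measurable_fun Om p ->
  (\forall x \ae mu, Om x -> `|v x| <= B) -> (\forall x \ae mu, Om x -> `|p x| <= B) ->
  L2 L (fun x => f (v x) (p x)).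
Proof.
move=> cf mv mp vB pB.
have [d d0 _] := uniform_cont_box B cf ltr01.
pose K : set (R * R) := `[- B, B]%classic `*` `[- B, B]%classic.
have cK : compact K by apply: compact_setX; exact: segment_compact.
have [M [Mr HM]] : bounded_set ((fun z : R * R => f z.1 z.2) @` K).
  apply: compact_bounded; apply: continuous_compact cK.
  exact: continuous_subspaceT.
apply: (@L2_ae_bounded _ _ _ (`|M| + 1)); first by rewrite addr_ge0.
  exact: measurable_fun_comp2.
apply: aeS2 vB pB => x hv hp xO.
apply: (HM (`|M| + 1)); first by rewrite (le_lt_trans (ler_norm M))// ltrDl.
exists (v x, p x) => //; split => /=; rewrite in_itv/= -ler_norml; [exact: hv|exact: hp].
Qed.

Section diffq_limit.
Variables (f I : R -> R -> R).
Hypothesis D : forall v p : R, is_derive v 1 (fun v' => I v' p) (f v p).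
Hypothesis cf : continuous (fun z : R * R => f z.1 z.2).
Hypothesis cI : continuous (fun z : R * R => I z.1 z.2).

Lemma measurable_diffq (v v0 p : R -> R) : measurable_fun Om v ->
  measurable_fun Om v0 -> measurable_fun Om p ->
  measurable_fun Om (fun x => diffq f I (v x) (v0 x) (p x)).
Proof.
move=> mv mv0 mp; apply: measurable_fun_if => //.
- exact: measurable_fun_eqr.
- apply: (@measurable_funS _ _ _ _ Om) => //.
  exact: measurable_fun_comp2.
- apply: (@measurable_funS _ _ _ _ Om) => //.
  apply: measurable_funM.
    by apply: measurable_funB; exact: measurable_fun_comp2.
  by apply: measurableT_comp; [exact: measurable_invr|exact: measurable_funB].
Qed.

Variables (T : Type) (F : set_system T) (FF : Filter F).
Variables (v p : T -> R -> R) (v0 p0 : R -> R) (B : R).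
Hypothesis mv : \forall s \near F, measurable_fun Om (v s).
Hypothesis mp : \forall s \near F, measurable_fun Om (p s).
Hypothesis mv0 : measurable_fun Om v0.
Hypothesis mp0 : measurable_fun Om p0.
Hypothesis v0B : \forall x \ae mu, Om x -> `|v0 x| <= B.
Hypothesis p0B : \forall x \ae mu, Om x -> `|p0 x| <= B.
Hypothesis sv : forall e, 0 < e ->
  \forall s \near F, \forall x \ae mu, Om x -> `|v s x - v0 x| <= e.
Hypothesis sp : forall e, 0 < e ->
  \forall s \near F, \forall x \ae mu, Om x -> `|p s x - p0 x| <= e.

Let Th s x := diffq f I (v s x) (v0 x) (p s x).

(** The intermediate point is no farther from v0 than v s is, so [uniform_cont_box] applies almost
    everywhere; [Th s] is in L2 as the limit plus a bounded difference. *)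
Let Th_close e : 0 < e -> \forall s \near F, [/\ L2 L (Th s) &
  \forall x \ae mu, Om x -> `|Th s x - f (v0 x) (p0 x)| <= e].
Proof.
move=> e0; have [d d0 Hd] := uniform_cont_box B cf e0.
near=> s.
have ae1 : \forall x \ae mu, Om x -> `|Th s x - f (v0 x) (p0 x)| <= e.
  have h1 : \forall x \ae mu, Om x -> `|v s x - v0 x| <= d by near: s; exact: sv.
  have h2 : \forall x \ae mu, Om x -> `|p s x - p0 x| <= d by near: s; exact: sp.
  have h3 : \forall x \ae mu, Om x -> `|v0 x| <= B /\ `|p0 x| <= B.
    by apply: aeS2 v0B p0B => x a b xO; split; [exact: a|exact: b].
  have h4 : \forall x \ae mu, Om x -> `|v s x - v0 x| <= d /\ `|p s x - p0 x| <= d.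
    by apply: aeS2 h1 h2 => x a b xO; split; [exact: a|exact: b].
  apply: aeS2 h3 h4 => x a b xO; have [v0x p0x] := a xO; have [vx px] := b xO.
  have [xi xib E] := diffq_mvt (v s x) (v0 x) (p s x) D; rewrite /Th E.
  by apply: Hd => //; exact: le_trans vx.
split => //.
have Lf := continuous_comp2_L2 cf mv0 mp0 v0B p0B.
have mTh : measurable_fun Om (Th s).
  by apply: measurable_diffq => //; near: s.
have Ld : L2 L (fun x => Th s x - f (v0 x) (p0 x)).
  apply: L2_ae_bounded (ltW e0) _ ae1.
  by apply: measurable_funB => //; exact: L2_measurable Lf.
have := L2D Ld Lf; rewrite (_ : (fun x => _) = Th s)//.
by apply/funext => x; rewrite subrK.
Unshelve. all: by end_near. Qed.

Lemma L2_diffq : \forall s \near F, L2 L (fun x => diffq f I (v s x) (v0 x) (p s x)).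
Proof. by apply: filterS (Th_close ltr01) => s []. Qed.

Lemma diffq_cvg : L2norm L (fun x => diffq f I (v s x) (v0 x) (p s x)
    - f (v0 x) (p0 x)) @[s --> F] --> (0 : R).
Proof.
apply/cvgrPdist_le => e e0.
have e'0 : 0 < e / Num.sqrt L by rewrite divr_gt0// sqrtr_gt0.
have Lf := continuous_comp2_L2 cf mv0 mp0 v0B p0B.
apply: filterS (Th_close e'0) => s [LTh ae1].
rewrite sub0r normrN ger0_norm ?L2norm_ge0//.
have := L2norm_le L_gt0 (ltW e'0) (L2B LTh Lf) ae1.
by rewrite divfK// gt_eqF// sqrtr_gt0.
Qed.

End diffq_limit.

End source.

(** * Differentiation in time *)

Section time.
Context {R : realType}.
Local Notation td := (time_dom (+oo%E : \bar R)).

Lemma time_dom_infty : td = `[0, +oo[%classic.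
Proof.
by apply/seteqP; split => t; rewrite /time_dom /= in_itv/= ?ltry andbT; [case|].
Qed.

Lemma time_domP (t : R) : td t <-> 0 <= t.
Proof. by rewrite time_dom_infty /= in_itv/= andbT. Qed.

Lemma near_within_dnbhs (t : R) (P : R -> Prop) :
  (\forall s \near within td (nbhs t), P s) -> \forall s \near within td t^', P s.
Proof. by move=> H; apply: (nbhs_dnbhs (t := fun s => td s -> P s)). Qed.

Lemma near_within_td (t : R) : \forall s \near within td (nbhs t), 0 <= s.
Proof. by rewrite near_withinE; apply: nearW => s /time_domP. Qed.

(** A time t > 0 is interior to the time domain, so the limit within that domain is two-sided. *)
Lemma is_derive_of_quotient (f : R -> R) (t l : R) : 0 < t ->
  (s - t)^-1 * (f s - f t) @[s --> within td t^'] --> l -> is_derive t 1 f l.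
Proof.
move=> t0 H.
have cv : h^-1 *: (f (h *: 1 + t) - f t) @[h --> 0^'] --> l.
  apply/cvgrPdist_le => e e0.
  have := (@cvgrPdist_le _ _ _ _ _ _ _).1 H e e0.
  rewrite near_withinE => -[r /= r0 Hr].
  exists (Num.min r t) => /=; first by rewrite lt_min r0.
  move=> h /=; rewrite sub0r normrN lt_min => /andP[hr ht] h0.
  have := Hr (h + t).
  rewrite /= [t - _](_ : _ = - h); last by ring.
  rewrite normrN addrK /GRing.scale/= mulr1; apply => //.
    by rewrite -subr_eq0 addrK.
  apply/time_domP; move: ht; rewrite ltr_norml => /andP[ht _]; lra.
apply: DeriveDef; first by apply/cvg_ex; exists l.
exact/cvg_lim.
Qed.

End time.

(** * Time derivatives of scalar products and of the source energy *)

Section regularity.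
Context {R : realType} (L : R).
Hypothesis L_gt0 : 0 < L.
Local Notation mu := (@lebesgue_measure R).
Local Notation Om := (Omega L).
Local Notation dx := (wderiv L).
Local Notation td := (time_dom (+oo%E : \bar R)).
Local Notation C0 := (class_C0 (L2 L) (L2norm L) +oo%E).
Local Notation C1 := (class_C1 (L2 L) (L2norm L) +oo%E).
Local Notation C1H := (class_C1 (H1star L) (H1norm L) +oo%E).
Let mOm : measurable Om := measurable_Omega L.
Local Hint Resolve mOm : core.

Lemma C0_L2 (a : R -> R -> R) t : C0 a -> 0 <= t -> L2 L (a t).
Proof. by move=> [H _] /time_domP; exact: H. Qed.

Lemma C0_near (a : R -> R -> R) (t : R) : C0 a -> \forall s \near within td (nbhs t), L2 L (a s).
Proof. by move=> Ca; apply: filterS (near_within_td t) => s; exact: C0_L2. Qed.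

Lemma ip_continuous (a b : R -> R -> R) : C0 a -> C0 b ->
  {within `[0, +oo[, continuous (fun s => ip L (a s) (b s))}.
Proof.
move=> Ca Cb; rewrite -time_dom_infty; apply/subspace_continuousP => t tt.
have t0 := (time_domP t).1 tt.
apply: ip_cvg; try exact: C0_near; try exact: C0_L2.
- exact: Ca.2.
- exact: Cb.2.
Qed.

Lemma is_derive_ip (a a' b b' : R -> R -> R) (t : R) : C1 a a' -> C1 b b' -> 0 < t ->
  is_derive t 1 (fun s => ip L (a s) (b s)) (ip L (a' t) (b t) + ip L (a t) (b' t)).
Proof.
move=> [Ca Ca' da] [Cb Cb' db] t0; have t0' := ltW t0; have tt := (time_domP t).2 t0'.
have La := C0_L2 Ca t0'; have Lb := C0_L2 Cb t0'.
apply: is_derive_of_quotient => //.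
have nL (c : R -> R -> R) : C0 c -> \forall s \near within td t^', L2 L (c s).
  by move=> Cc; apply: near_within_dnbhs; exact: C0_near.
have nLq (c : R -> R -> R) : C0 c ->
    \forall s \near within td t^', L2 L (fun x => (s - t)^-1 * (c s x - c t x)).
  move=> Cc; apply: filterS (nL _ Cc) => s Ls.
  by apply: L2Z; apply: L2B => //; exact: C0_L2 Cc t0'.
(* The increment of the product splits into (a s - a t) b s + a t (b s - b t). *)
have : ip L (fun x => (s - t)^-1 * (a s x - a t x)) (b s) +
    ip L (a t) (fun x => (s - t)^-1 * (b s x - b t x)) @[s --> within td t^'] -->
    ip L (a' t) (b t) + ip L (a t) (b' t).
  apply: cvgD; apply: ip_cvg.
  - exact: nLq.
  - exact: nL.
  - exact: C0_L2.
  - exact: Lb.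
  - exact: da.
  - by move=> P /(Cb.2 t tt) HP; exact: near_within_dnbhs HP.
  - exact: nearW.
  - exact: nLq.
  - exact: La.
  - exact: C0_L2.
  - rewrite (_ : (fun x => _) = fun=> 0) /=; last first.
      apply/funext => s; rewrite (_ : (fun x => _) = cst 0).
        apply/eqP; rewrite -sqrf_eq0 L2norm_sqr; last exact: L2_cst.
        by rewrite /ip; under eq_Rintegral do rewrite mul0r; rewrite Rintegral_cst// mul0r.
      by apply/funext => x; rewrite subrr.
    exact: cvg_cst.
  - exact: db.
apply: cvg_trans; apply: near_eq_cvg.
apply: filterS2 (nL _ Ca) (nL _ Cb) => s Las Lbs.
have Ld1 : L2 L (fun x => a s x - a t x) by exact: L2B.
have Ld2 : L2 L (fun x => b s x - b t x) by exact: L2B.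
by rewrite ipZl// ipZr// ipBl// ipBr//; ring.
Qed.

Lemma H1norm_ge (g : R -> R) : L2norm L (dx g) <= H1norm L g.
Proof.
rewrite /H1norm -[leLHS]ger0_norm ?L2norm_ge0// -sqrtr_sqr.
by rewrite ler_wsqrtr// lerDr sqr_ge0.
Qed.

Lemma H1B (g h : R -> R) : H1 L g -> H1 L h ->
  H1 L (fun x => g x - h x) /\
  dx (fun x => g x - h x) = (fun x => dx g x - dx h x) %[ae mu in Om].
Proof.
move=> Hg Hh; have := H1DZ L_gt0 (-1) Hg Hh.
rewrite (_ : (fun x => g x + -1 * h x) = (fun x => g x - h x)).
  by move=> [H E]; split => //; apply: aeS E => x H' /H' ->; rewrite mulN1r.
by apply/funext => x; rewrite mulN1r.
Qed.

Lemma H1Z (k : R) (h : R -> R) : H1 L h ->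
  H1 L (fun x => k * h x) /\ dx (fun x => k * h x) = (fun x => k * dx h x) %[ae mu in Om].
Proof.
(* The zero function is written as h - h so that [H1DZ] yields the pure multiple k h. *)
move=> Hh; have [H0 E0] := H1B Hh Hh; have := H1DZ L_gt0 k H0 Hh.
rewrite (_ : (fun x => h x - h x + k * h x) = (fun x => k * h x)).
  move=> [H E]; split => //; apply: aeS2 E E0 => x h1 h2 xO.
  by rewrite h1// h2// subrr add0r.
by apply/funext => x; rewrite subrr add0r.
Qed.

Lemma C0H_wderiv (w : R -> R -> R) :
  class_C0 (H1star L) (H1norm L) +oo%E w -> C0 (fun t => dx (w t)).
Proof.
move=> [Hw cw]; split; first by move=> t /Hw [H _]; exact: wderiv_L2.
move=> t tt; have [Ht _] := Hw t tt.
apply: (@squeeze_cvgr _ _ _ _ (fun=> 0) (fun s => H1norm L (fun x => w s x - w t x))).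
- apply: filterS (near_within_td t) => s /time_domP /Hw [Hs _].
  rewrite L2norm_ge0 /=; have [H E] := H1B Hs Ht.
  rewrite -(L2norm_ae _ _ E); first exact: H1norm_ge.
    exact: wderiv_L2.
  by apply: L2B; exact: wderiv_L2.
- exact: cvg_cst.
- exact: cw.
Qed.

(** The exchange of the derivatives in x and t: the H^1 norm of the error of the difference quotient
    dominates the L2 norm of its derivative in x. It makes the elastic energy differentiable. *)
Lemma C1H_wderiv (w w' : R -> R -> R) : C1H w w' ->
  C1 (fun t => dx (w t)) (fun t => dx (w' t)).
Proof.
move=> [Cw Cw' dw]; split; [exact: C0H_wderiv|exact: C0H_wderiv|].
move=> t tt; have [Ht _] := Cw.1 t tt; have [Ht' _] := Cw'.1 t tt.
apply: (@squeeze_cvgr _ _ _ _ (fun=> 0)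
  (fun s => H1norm L (fun x => (s - t)^-1 * (w s x - w t x) - w' t x))).
- apply: near_within_dnbhs; apply: filterS (near_within_td t) => s /time_domP /(Cw.1) [Hs _].
  rewrite L2norm_ge0 /=.
  have [H1 E1] := H1B Hs Ht; have [H2 E2] := H1Z (s - t)^-1 H1.
  have [H3 E3] := H1B H2 Ht'.
  have E : dx (fun x => (s - t)^-1 * (w s x - w t x) - w' t x) =
      (fun x => (s - t)^-1 * (dx (w s) x - dx (w t) x) - dx (w' t) x) %[ae mu in Om].
    apply: aeS2 E3 (aeS2 (fun x a b => conj a b) E1 E2) => x h3 [h1 h2] xO.
    by rewrite h3// h2// h1.
  rewrite -(L2norm_ae _ _ E); first exact: H1norm_ge.
    exact: wderiv_L2.
  by apply: L2B; [apply: L2Z; apply: L2B|]; exact: wderiv_L2.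
- exact: cvg_cst.
- exact: dw.
Qed.

(** Turns continuity in H^1 into uniform convergence on the interval. *)
Lemma H1star_dist (g h : R -> R) : H1star L g -> H1star L h ->
  \forall x \ae mu, Om x ->
    `|g x - h x| <= L2norm L (fun y => dx g y - dx h y) * Num.sqrt L.
Proof.
move=> Hg Hh; have Lg := wderiv_L2 Hg.1; have Lh := wderiv_L2 Hh.1.
apply: aeS2 (H1star_prim L_gt0 Hg) (H1star_prim L_gt0 Hh) => x hg hh xO.
rewrite hg// hh//.
have -> : primitive L (dx g) x - primitive L (dx h) x = primitive L (fun y => dx g y - dx h y) x.
  rewrite !primE -RintegralB//; last 2 first.
  - by apply: integrable_indic_mul => //; exact: L2_integrable.
  - by apply: integrable_indic_mul => //; exact: L2_integrable.
  by apply: eq_Rintegral => y _; rewrite mulrBl.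
by apply: prim_bound => //; exact: L2B.
Qed.

Section source_energy.
Variables (I f1 f2 : R -> R -> R) (v v' p p' : R -> R -> R).
Hypothesis HG : G1 I f1 f2.
Hypothesis Hv : class_C0 (H1star L) (H1norm L) +oo%E v.
Hypothesis Hp : class_C0 (H1star L) (H1norm L) +oo%E p.
Hypothesis Cv : C1 v v'.
Hypothesis Cp : C1 p p'.

Let S (t : R) := \int[mu]_(x in Om) I (v t x) (p t x).

Let cf1 : continuous (fun z : R * R => f1 z.1 z.2). Proof. by case: HG. Qed.
Let cf2 : continuous (fun z : R * R => f2 z.1 z.2). Proof. by case: HG. Qed.
Let cI : continuous (fun z : R * R => I z.1 z.2).
Proof. by case: HG => _ dI _ _ _ z; apply: differentiable_continuous. Qed.

Let swap (f : R -> R -> R) : continuous (fun z : R * R => f z.1 z.2) ->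
  continuous (fun z : R * R => f z.2 z.1).
Proof.
move=> cf z; apply: (@continuous_comp _ _ _ (fun z : R * R => (z.2, z.1))
  (fun z : R * R => f z.1 z.2)); last exact: cf.
exact: swap_continuous.
Qed.

Let D1 (a b : R) : is_derive a 1 (fun a => I a b) (f1 a b).
Proof. by case: HG => _ _ /(_ a b) []. Qed.

Let D2 (b a : R) : is_derive b 1 (fun b => I a b) (f2 a b).
Proof. by case: HG => _ _ /(_ a b) []. Qed.

Let bound (t : R) := Num.max (L2norm L (dx (v t)) * Num.sqrt L)
                             (L2norm L (dx (p t)) * Num.sqrt L).

Let vB (t : R) : 0 <= t -> \forall x \ae mu, Om x -> `|v t x| <= bound t.
Proof.
move=> /time_domP /(Hv.1) H; apply: aeS (H1star_bound L_gt0 H) => x h xO.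
by rewrite le_max h.
Qed.

Let pB (t : R) : 0 <= t -> \forall x \ae mu, Om x -> `|p t x| <= bound t.
Proof.
move=> /time_domP /(Hp.1) H; apply: aeS (H1star_bound L_gt0 H) => x h xO.
by rewrite le_max h// orbT.
Qed.

Let mv (t : R) : 0 <= t -> measurable_fun Om (v t).
Proof. by move=> t0; apply: L2_measurable; have [C _ _] := Cv; exact: C0_L2 C t0. Qed.

Let mp (t : R) : 0 <= t -> measurable_fun Om (p t).
Proof. by move=> t0; apply: L2_measurable; have [C _ _] := Cp; exact: C0_L2 C t0. Qed.

Lemma source_L2 (f : R -> R -> R) (t : R) :
  continuous (fun z : R * R => f z.1 z.2) -> 0 <= t -> L2 L (fun x => f (v t x) (p t x)).
Proof.
by move=> cf t0; exact: (continuous_comp2_L2 cf (mv t0) (mp t0) (vB t0) (pB t0)).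
Qed.

Let sup_cvg (w : R -> R -> R) (t : R) : class_C0 (H1star L) (H1norm L) +oo%E w -> 0 <= t ->
  forall e, 0 < e -> \forall s \near within td (nbhs t),
    \forall x \ae mu, Om x -> `|w s x - w t x| <= e.
Proof.
move=> Hw t0 e e0; have tt := (time_domP t).2 t0.
have Cdw := C0H_wderiv Hw.
have e'0 : 0 < e / Num.sqrt L by rewrite divr_gt0// sqrtr_gt0.
have H : \forall s \near within td (nbhs t),
    L2norm L (fun y => dx (w s) y - dx (w t) y) <= e / Num.sqrt L.
  move/cvgrPdist_le : (Cdw.2 t tt) => /(_ _ e'0); apply: filterS => s.
  by rewrite sub0r normrN ger0_norm ?L2norm_ge0.
near=> s.
have s0 : td s by apply/time_domP; near: s; exact: near_within_td.
have dist := H1star_dist (Hw.1 s s0) (Hw.1 t tt).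
apply: aeS dist => x h xO; apply: le_trans (h xO) _.
rewrite -ler_pdivlMr ?sqrtr_gt0//.
by near: s; exact: H.
Unshelve. all: by end_near. Qed.

(** The increment of I passes through the state (v t, p s): [Th2] moves p with v still at time t,
    then [Th1] moves v with p already at time s. *)
Let Th1 (t s x : R) := diffq f1 I (v s x) (v t x) (p s x).
Let Th2 (t s x : R) := diffq (fun b a => f2 a b) (fun b a => I a b) (p s x) (p t x) (v t x).

Let S_diff (t : R) : 0 <= t -> \forall s \near within td (nbhs t),
  [/\ L2 L (Th1 t s), L2 L (Th2 t s) &
  S s - S t = ip L (Th1 t s) (fun x => v s x - v t x) +
              ip L (Th2 t s) (fun x => p s x - p t x)].
Proof.
move=> t0.
have [Cv0 _ _] := Cv; have [Cp0 _ _] := Cp.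
have n1 : \forall s \near within td (nbhs t), L2 L (Th1 t s).
  apply: (L2_diffq D1 cf1 cI _ _ _ (mv t0) (mp t0) (vB t0) (pB t0)).
  - by apply: filterS (near_within_td t) => s; exact: mv.
  - by apply: filterS (near_within_td t) => s; exact: mp.
  - exact: sup_cvg.
  - exact: sup_cvg.
have n2 : \forall s \near within td (nbhs t), L2 L (Th2 t s).
  apply: (L2_diffq (p := fun=> v t) D2 (swap cf2) (swap cI) _ _ _ (mp t0) (mv t0) (pB t0) (vB t0)).
  - by apply: filterS (near_within_td t) => s; exact: mp.
  - by apply: nearW => _; exact: mv.
  - exact: sup_cvg.
  - by move=> e e0; apply: nearW => _; apply: aeW => x _; rewrite subrr normr0 ltW.
apply: filterS3 (near_within_td t) n1 n2 => s s0 L1 L2'; split => //.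
have Lvs := C0_L2 Cv0 s0; have Lvt := C0_L2 Cv0 t0.
have Lps := C0_L2 Cp0 s0; have Lpt := C0_L2 Cp0 t0.
rewrite /S -RintegralB//; last 2 first.
- exact: L2_integrable (source_L2 cI s0).
- exact: L2_integrable (source_L2 cI t0).
rewrite /ip -RintegralD//; last 2 first.
- by apply: L2_mul_integrable => //; exact: L2B.
- by apply: L2_mul_integrable => //; exact: L2B.
apply: eq_Rintegral => x _; rewrite /Th1 /Th2.
by rewrite -(diffqE f1 I) -(diffqE (fun b a => f2 a b) (fun b a => I a b)); ring.
Qed.

Let Th1_cvg (t : R) : 0 <= t -> L2norm L (fun x => Th1 t s x - f1 (v t x) (p t x))
  @[s --> within td (nbhs t)] --> (0 : R).
Proof.
move=> t0; apply: (diffq_cvg L_gt0 D1 cf1 cI _ _ _ (mv t0) (mp t0) (vB t0) (pB t0)).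
- by apply: filterS (near_within_td t) => s; exact: mv.
- by apply: filterS (near_within_td t) => s; exact: mp.
- exact: sup_cvg.
- exact: sup_cvg.
Qed.

Let Th2_cvg (t : R) : 0 <= t -> L2norm L (fun x => Th2 t s x - f2 (v t x) (p t x))
  @[s --> within td (nbhs t)] --> (0 : R).
Proof.
move=> t0.
apply: (diffq_cvg (p := fun=> v t) L_gt0 D2 (swap cf2) (swap cI) _ _ _ (mp t0) (mv t0) (pB t0) (vB t0)).
- by apply: filterS (near_within_td t) => s; exact: mp.
- by apply: nearW => _; exact: mv.
- exact: sup_cvg.
- by move=> e e0; apply: nearW => _; apply: aeW => x _; rewrite subrr normr0 ltW.
Qed.

(* The increment of the source energy is the sum of two L2 scalar products of
   difference quotients of I with increments of v and p; the former converge
   uniformly because H^1 controls the sup norm. *)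
Lemma is_derive_source (t : R) : 0 < t -> is_derive t 1 S
  (ip L (fun x => f1 (v t x) (p t x)) (v' t) + ip L (fun x => f2 (v t x) (p t x)) (p' t)).
Proof.
move=> t_gt0; have t0 := ltW t_gt0; have tt := (time_domP t).2 t0.
have [Cv0 Cv' dv] := Cv; have [Cp0 Cp' dp] := Cp.
apply: is_derive_of_quotient => //.
have nLq (c : R -> R -> R) : C0 c ->
    \forall s \near within td t^', L2 L (fun x => (s - t)^-1 * (c s x - c t x)).
  move=> Cc; apply: near_within_dnbhs; apply: filterS (C0_near t Cc) => s Ls.
  by apply: L2Z; apply: L2B => //; exact: C0_L2 Cc t0.
have SD := near_within_dnbhs (S_diff t0).
have : ip L (Th1 t s) (fun x => (s - t)^-1 * (v s x - v t x)) +
    ip L (Th2 t s) (fun x => (s - t)^-1 * (p s x - p t x)) @[s --> within td t^'] -->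
  ip L (fun x => f1 (v t x) (p t x)) (v' t) + ip L (fun x => f2 (v t x) (p t x)) (p' t).
  apply: cvgD; apply: ip_cvg.
  - by apply: filterS SD => s [].
  - exact: nLq.
  - exact: source_L2.
  - exact: C0_L2.
  - by move=> P /(Th1_cvg t0) HP; exact: near_within_dnbhs HP.
  - exact: dv.
  - by apply: filterS SD => s [].
  - exact: nLq.
  - exact: source_L2.
  - exact: C0_L2.
  - by move=> P /(Th2_cvg t0) HP; exact: near_within_dnbhs HP.
  - exact: dp.
apply: cvg_trans; apply: near_eq_cvg.
apply: filterS3 SD (near_within_dnbhs (C0_near t Cv0)) (near_within_dnbhs (C0_near t Cp0))
  => s [L1 L2' ->] Lvs Lps.
have Ld1 : L2 L (fun x => v s x - v t x) by apply: L2B => //; exact: C0_L2 Cv0 t0.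
have Ld2 : L2 L (fun x => p s x - p t x) by apply: L2B => //; exact: C0_L2 Cp0 t0.
by rewrite !ipZr// mulrDr.
Qed.

(** Covers time 0, outside the scope of [is_derive_source]: the quotients converge in L2 while the
    increments of v and p tend to 0. *)
Lemma source_continuous : {within `[0, +oo[, continuous S}.
Proof.
rewrite -time_dom_infty; apply/subspace_continuousP => t tt.
have t0 := (time_domP t).1 tt.
have [Cv0 _ _] := Cv; have [Cp0 _ _] := Cp.
have L0 : L2 L (cst 0 : R -> R) := L2_cst L 0.
have ip0 g : ip L g (cst 0) = 0.
  by rewrite /ip; under eq_Rintegral do rewrite mulr0; rewrite Rintegral_cst// mul0r.
have c0 (c : R -> R -> R) : C0 c -> L2norm L (fun x => (c s x - c t x) - cst 0 x)
    @[s --> within td (nbhs t)] --> (0 : R).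
  move=> Cc; rewrite (_ : (fun s => _) = fun s => L2norm L (fun x => c s x - c t x)).
    exact: Cc.2.
  by apply/funext => s; congr L2norm; apply/funext => x; rewrite subr0.
apply/subr_cvg0.
have : ip L (Th1 t s) (fun x => v s x - v t x) +
    ip L (Th2 t s) (fun x => p s x - p t x) @[s --> within td (nbhs t)] -->
  ip L (fun x => f1 (v t x) (p t x)) (cst 0) + ip L (fun x => f2 (v t x) (p t x)) (cst 0).
  apply: cvgD; apply: ip_cvg => //.
  - by apply: filterS (S_diff t0) => s [].
  - by apply: filterS (C0_near t Cv0) => s Ls; apply: L2B => //; exact: C0_L2 Cv0 t0.
  - exact: source_L2.
  - exact: Th1_cvg.
  - exact: c0.
  - by apply: filterS (S_diff t0) => s [].
  - by apply: filterS (C0_near t Cp0) => s Ls; apply: L2B => //; exact: C0_L2 Cp0 t0.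
  - exact: source_L2.
  - exact: Th2_cvg.
  - exact: c0.
rewrite !ip0 addr0; apply: cvg_trans; apply: near_eq_cvg.
by apply: filterS (S_diff t0) => s [_ _ ->].
Qed.

End source_energy.

End regularity.

(** * Energy and blow-up *)

Lemma is_derive_congr (R : realType) (f g : R -> R) (t l m : R) :
  is_derive t 1 f l -> f =1 g -> l = m -> is_derive t 1 g m.
Proof. by move=> h /funext <- <-. Qed.

Lemma G2_pointwise (R : realType) (L eta : R) (I f1 f2 : R -> R -> R) : 0 < L ->
  continuous (fun z : R * R => I z.1 z.2) ->
  continuous (fun z : R * R => f1 z.1 z.2) ->
  continuous (fun z : R * R => f2 z.1 z.2) -> G2 L I f1 f2 eta ->
  forall a b, 0 <= a * f1 a b + b * f2 a b - eta * I a b.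
Proof.
move=> L_gt0 cI cf1 cf2 HG a b.
(* The integrand along the ray through (a, b). Testing with a and b times a plateau gives the
   integral of g (plateau), which tends to L g(1); as plateaus take values in [[0, 1]], a bound of g
   there dominates. *)
pose g (r : R) := (a * r) * f1 (a * r) (b * r) + (b * r) * f2 (a * r) (b * r)
  - eta * I (a * r) (b * r).
have cg : continuous g.
  have cl (k : R) : continuous (fun r : R => k * r).
    by move=> r; apply: cvgM; [exact: cvg_cst|exact: cvg_id].
  have c2 (f : R -> R -> R) : continuous (fun z : R * R => f z.1 z.2) ->
      continuous (fun r => f (a * r) (b * r)).
    move=> cf r; apply: (@continuous_comp _ _ _ (fun r => (a * r, b * r))
      (fun z : R * R => f z.1 z.2)); last exact: cf.
    exact: cvg_pair (cl a r) (cl b r).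
  move=> r; apply: cvgB; first apply: cvgD.
  - by apply: cvgM; [exact: cl|exact: (c2 f1)].
  - by apply: cvgM; [exact: cl|exact: (c2 f2)].
  - by apply: cvgM; [exact: cvg_cst|exact: (c2 I)].
have mO := measurable_Omega L.
have [M HM] : exists M, forall r, 0 <= r <= 1 -> `|g r| <= M.
  have cn : {within `[0, 1], continuous (fun x => `|g x|)}.
    by apply: continuous_subspaceT => x; apply: cvg_norm; exact: cg.
  have [c _ H] := EVT_max ler01 cn.
  by exists `|g c| => r rI; apply: H; rewrite in_itv.
have C : \int[lebesgue_measure]_(x in Omega L) g (plateau L n x) @[n --> \oo] -->
    (\int[lebesgue_measure]_(x in Omega L) g 1 : R).
  apply: (@Rintegral_dct _ _ _ _ (cst M)).
  - move=> n; apply: measurable_funTS.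
    apply: measurableT_comp; apply: continuous_measurable_fun => //.
    exact: continuous_plateau.
  - by [].
  - exact: L2_integrable (L2_cst L M).
  - move=> x xO.
    have h := @plateau_cvg _ L x L_gt0.
    have e : (\1_(`]0, L[%classic) x : R) = 1 by rewrite indicE mem_set.
    rewrite e in h; exact: (@continuous_cvg _ _ _ _ _ _ g _ (cg 1) h).
  - by move=> n x _; apply: HM; exact: plateau_itv.
have : 0 <= \int[lebesgue_measure]_(x in Omega L) g 1.
  apply: (cvgr_to_ge C); apply: nearW => n.
  have := HG (fun x => a * plateau L n x) (fun x => b * plateau L n x).
  by apply; apply: (test_H10 L_gt0); exact: plateau_test.
by rewrite Rintegral_cst// mu_Om// pmulr_lge0// /g !mulr1.
Qed.

(** * Algebra of the energy and virial identities *)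

Section identities.
Context {R : realType}.
Implicit Types x y z : R.

(** Completing the square: this is where a - g^2 b becomes the coefficient that must be positive. *)
Lemma quad_form_split (a b g : R) x y z :
  a * x - 2 * (g * b) * y + b * z = (a - g ^+ 2 * b) * x + b * (g ^+ 2 * x - 2 * g * y + z).
Proof. by ring. Qed.

Lemma weak_formE (a b l x y z t f ay bz lt y' z' : R) :
  x - ay + bz + lt = f -> ay = a * y -> bz = b * z -> lt = l * t ->
  y' = - y -> z' = - z -> x = b * z' - a * y' - l * t + f.
Proof. by move=> <- -> -> -> -> ->; ring. Qed.

Lemma quad_derivativeE (a b c w x y z : R) :
  a * (2 * x) + - (2 * c) * (w + z) + b * (2 * y) = 2 * (a * x + b * y - c * (w + z)).
Proof. by ring. Qed.

Lemma kinetic_derivativeE x y : 2 * x + 1 * (2 * y) = 2 * (x + y).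
Proof. by ring. Qed.

(** The stiffness, coupling and source terms coming from the tested equations cancel those in the
    derivative of H; only the damping survives. *)
Lemma dissipationE (a b c l m kv kp wv wp s1 s2 x1 x2 x3 x4 : R) :
  wv = c * x2 - a * x1 - l * kv + s1 -> wp = c * x3 - b * x4 - m * kp + s2 ->
  (s1 + s2) + - 2^-1 * (2 * (a * x1 + b * x4 - c * (x2 + x3)) + 1 * (2 * (wv + wp)))
  = l * kv + m * kp.
Proof. by move=> -> ->; field. Qed.

Lemma virialE (a b c l m kv kp wv wp s1 s2 x y z m1 m2 : R) :
  wv = c * y - a * x - l * m1 + s1 -> wp = c * y - b * z - m * m2 + s2 ->
  (kv + wv + (kp + wp)) + (l * m1 + m * m2) =
  (kv + kp) - (a * x - 2 * c * y + b * z) + (s1 + s2).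
Proof. by move=> -> ->; ring. Qed.

Lemma concavity_gapE (e k q s : R) : (1 + e / 2) * k + e * (s - 2^-1 * (q + k)) =
  k - q + e * s - (e - 2) / 2 * q.
Proof. by field. Qed.

Lemma square_expandE (g a b b' c gg gb bg' gx : R) :
  gg = g * gx -> gx = g * a -> gb = g * b -> bg' = g * b' -> b' = b ->
  gg - gb - (bg' - c) = g ^+ 2 * a - 2 * g * b + c.
Proof. by move=> -> -> -> -> ->; ring. Qed.

End identities.

Section weak_form.
Context {R : realType} (L : R).
Hypothesis L_gt0 : 0 < L.
Local Notation mu := (@lebesgue_measure R).
Local Notation Om := (Omega L).
Local Notation dx := (wderiv L).

(** Integration by parts applies to dx w and dx q, which vanish at L, against z, which vanishes at
    0. The choice of v_t and p_t for z gives the energy identity, that of v and p the virial one. *)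
Lemma weak_form (a b l : R) (wtt wt w q F z : R -> R) :
  L2 L wtt -> L2 L wt -> L2 L F -> H1 L (dx w) -> H1 L (dx q) ->
  crep L (dx w) L = 0 -> crep L (dx q) L = 0 -> H1star L z ->
  (\forall x \ae mu, Om x ->
    wtt x - a * dx (dx w) x + b * dx (dx q) x + l * wt x = F x) ->
  ip L wtt z = b * ip L (dx q) (dx z) - a * ip L (dx w) (dx z) - l * ip L wt z + ip L F z.
Proof.
move=> Ltt Lt LF Hw Hq wL qL Hz E.
have Lw := wderiv_L2 Hw; have Lq := wderiv_L2 Hq; have Lz := Hz.1.1.
have L1 : L2 L (fun x => a * dx (dx w) x) by exact: L2Z.
have L2' : L2 L (fun x => b * dx (dx q) x) by exact: L2Z.
have L3 : L2 L (fun x => l * wt x) by exact: L2Z.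
have L4 : L2 L (fun x => wtt x - a * dx (dx w) x) by exact: L2B.
have L5 : L2 L (fun x => wtt x - a * dx (dx w) x + b * dx (dx q) x) by exact: L2D.
have L6 : L2 L (fun x => wtt x - a * dx (dx w) x + b * dx (dx q) x + l * wt x) by exact: L2D.
have := ip_ae L6 LF Lz Lz E (aeW _ (fun _ _ => erefl)).
rewrite (ipDl L5 L3 Lz) (ipDl L4 L2' Lz) (ipBl Ltt L1 Lz).
move=> e; have ew := ip_wderiv L_gt0 Hw wL Hz; have eq := ip_wderiv L_gt0 Hq qL Hz.
exact: (weak_formE e (ipZl a Lw Lz) (ipZl b Lq Lz) (ipZl l Lt Lz) ew eq).
Qed.

End weak_form.

Lemma integrable_add (R : realType) (L : R) (f g : R -> R) :
  (@lebesgue_measure R).-integrable (Omega L) (EFin \o f) ->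
  (@lebesgue_measure R).-integrable (Omega L) (EFin \o g) ->
  (@lebesgue_measure R).-integrable (Omega L) (EFin \o (fun x => f x + g x)).
Proof.
move=> i1 i2; rewrite (_ : EFin \o _ = (EFin \o f) \+ (EFin \o g))%E//.
by apply: integrableD => //; exact: measurable_Omega.
Qed.

Section global_solution.
Context {R : realType} (L alpha beta gamma lambda1 lambda2 eta : R).
Variables (I f1 f2 : R -> R -> R) (v vt vtt p pt ptt : R -> R -> R).
Local Notation mu := (@lebesgue_measure R).
Local Notation Om := (Omega L).
Local Notation dx := (wderiv L).
Local Notation C0 := (class_C0 (L2 L) (L2norm L) +oo%E).
Local Notation C1 := (class_C1 (L2 L) (L2norm L) +oo%E).
Local Notation C1H := (class_C1 (H1star L) (H1norm L) +oo%E).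
Hypothesis L_gt0 : 0 < L.
Hypothesis beta_gt0 : 0 < beta.
Hypothesis lambda1_gt0 : 0 < lambda1.
Hypothesis lambda2_gt0 : 0 < lambda2.
Hypothesis alpha1_gt0 : 0 < alpha - gamma ^+ 2 * beta.
Hypothesis HG1 : G1 I f1 f2.
Hypothesis eta2 : 2 < eta.
Hypothesis HG2 : G2 L I f1 f2 eta.
Hypothesis Rv : regular L +oo%E v vt vtt.
Hypothesis Rp : regular L +oo%E p pt ptt.
Hypothesis eqv : forall t : R, 0 < t -> \forall x \ae mu, Om x ->
  vtt t x - alpha * dx (dx (v t)) x + gamma * beta * dx (dx (p t)) x
    + lambda1 * vt t x = f1 (v t x) (p t x).
Hypothesis eqp : forall t : R, 0 < t -> \forall x \ae mu, Om x ->
  ptt t x - beta * dx (dx (p t)) x + gamma * beta * dx (dx (v t)) x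
    + lambda2 * pt t x = f2 (v t x) (p t x).
Hypothesis bc : forall t : R, 0 <= t ->
  crep L (dx (v t)) L = 0 /\ crep L (dx (p t)) L = 0.

Let vH t : 0 <= t -> (H2 L `&` H1star L) (v t).
Proof. by case: Rv => -[H _] _ _ /time_domP; exact: H. Qed.
Let pH t : 0 <= t -> (H2 L `&` H1star L) (p t).
Proof. by case: Rp => -[H _] _ _ /time_domP; exact: H. Qed.
Let vC1H : C1H v vt. Proof. by case: Rv. Qed.
Let pC1H : C1H p pt. Proof. by case: Rp. Qed.
Let vC1 : C1 v vt. Proof. by case: Rv => _ _ []. Qed.
Let pC1 : C1 p pt. Proof. by case: Rp => _ _ []. Qed.
Let vtC1 : C1 vt vtt. Proof. by case: Rv => _ _ []. Qed.
Let ptC1 : C1 pt ptt. Proof. by case: Rp => _ _ []. Qed.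
Let dvC1 := C1H_wderiv L_gt0 vC1H.
Let dpC1 := C1H_wderiv L_gt0 pC1H.
Let C1_C0 (a b : R -> R -> R) : C1 a b -> C0 a. Proof. by case. Qed.
Let C1_C0' (a b : R -> R -> R) : C1 a b -> C0 b. Proof. by case. Qed.

Let vt_star t : 0 <= t -> H1star L (vt t).
Proof. by case: vC1H => _ [H _] _ /time_domP; exact: H. Qed.
Let pt_star t : 0 <= t -> H1star L (pt t).
Proof. by case: pC1H => _ [H _] _ /time_domP; exact: H. Qed.

Let cI : continuous (fun z : R * R => I z.1 z.2).
Proof. by case: HG1 => _ dI _ _ _ z; apply: differentiable_continuous. Qed.
Let cf1 : continuous (fun z : R * R => f1 z.1 z.2). Proof. by case: HG1. Qed.
Let cf2 : continuous (fun z : R * R => f2 z.1 z.2). Proof. by case: HG1. Qed.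

Let F1 t x := f1 (v t x) (p t x).
Let F2 t x := f2 (v t x) (p t x).
Let vC0H : class_C0 (H1star L) (H1norm L) +oo%E v. Proof. by case: vC1H. Qed.
Let pC0H : class_C0 (H1star L) (H1norm L) +oo%E p. Proof. by case: pC1H. Qed.

Let F1_L2 t : 0 <= t -> L2 L (F1 t).
Proof. exact: (source_L2 L_gt0 vC0H pC0H vC1 pC1 cf1). Qed.
Let F2_L2 t : 0 <= t -> L2 L (F2 t).
Proof. exact: (source_L2 L_gt0 vC0H pC0H vC1 pC1 cf2). Qed.
Let I_L2 t : 0 <= t -> L2 L (fun x => I (v t x) (p t x)).
Proof. exact: (source_L2 L_gt0 vC0H pC0H vC1 pC1 cI). Qed.

Let S t := \int[mu]_(x in Om) I (v t x) (p t x).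

Let source_ge t : 0 <= t -> eta * S t <= ip L (F1 t) (v t) + ip L (F2 t) (p t).
Proof.
move=> t0; have Lv := C0_L2 (C1_C0 vC1) t0; have Lp := C0_L2 (C1_C0 pC1) t0.
have mO := measurable_Omega L.
rewrite /S -RintegralZl//; last exact: L2_integrable (I_L2 t0).
rewrite /ip -RintegralD//; last 2 first.
- by apply: L2_mul_integrable => //; exact: F1_L2.
- by apply: L2_mul_integrable => //; exact: F2_L2.
apply: le_Rintegral => //.
- exact: L2_integrable (L2Z eta (I_L2 t0)).
- by apply: integrable_add; apply: L2_mul_integrable => //; [exact: F1_L2|exact: F2_L2].
- move=> x _; have := G2_pointwise L_gt0 cI cf1 cf2 HG2 (v t x) (p t x).
  by rewrite subr_ge0 (mulrC (v t x)) (mulrC (p t x)).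
Qed.

Let weak_v t z : 0 < t -> H1star L z ->
  ip L (vtt t) z = gamma * beta * ip L (dx (p t)) (dx z) - alpha * ip L (dx (v t)) (dx z)
    - lambda1 * ip L (vt t) z + ip L (F1 t) z.
Proof.
move=> t_gt0 Hz; have t0 := ltW t_gt0; have [bv bp] := bc t0.
apply: (weak_form L_gt0) => //.
- exact: C0_L2 (C1_C0' vtC1) t0.
- exact: C0_L2 (C1_C0 vtC1) t0.
- exact: F1_L2.
- exact: (vH t0).1.2.
- exact: (pH t0).1.2.
- exact: eqv.
Qed.

Let weak_p t z : 0 < t -> H1star L z ->
  ip L (ptt t) z = gamma * beta * ip L (dx (v t)) (dx z) - beta * ip L (dx (p t)) (dx z)
    - lambda2 * ip L (pt t) z + ip L (F2 t) z.
Proof.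
move=> t_gt0 Hz; have t0 := ltW t_gt0; have [bv bp] := bc t0.
apply: (weak_form L_gt0) => //.
- exact: C0_L2 (C1_C0' ptC1) t0.
- exact: C0_L2 (C1_C0 ptC1) t0.
- exact: F2_L2.
- exact: (pH t0).1.2.
- exact: (vH t0).1.2.
- exact: eqp.
Qed.

Let A t := ip L (v t) (v t) + ip L (p t) (p t).
Let D t := lambda1 * ip L (v t) (v t) + lambda2 * ip L (p t) (p t).
Let M t := ip L (v t) (vt t) + ip L (p t) (pt t).
Let N t := lambda1 * ip L (v t) (vt t) + lambda2 * ip L (p t) (pt t).
Let K t := ip L (vt t) (vt t) + ip L (pt t) (pt t).
Let KD t := lambda1 * ip L (vt t) (vt t) + lambda2 * ip L (pt t) (pt t).
Let Q t := alpha * ip L (dx (v t)) (dx (v t))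
  - 2 * (gamma * beta) * ip L (dx (v t)) (dx (p t)) + beta * ip L (dx (p t)) (dx (p t)).
Let H t := S t - 2^-1 * (Q t + K t).
Let dM t := ip L (vt t) (vt t) + ip L (v t) (vtt t) + (ip L (pt t) (pt t) + ip L (p t) (ptt t)).

Local Opaque ip wderiv.

Let Q_ge0 t : 0 <= t -> 0 <= Q t.
Proof.
move=> t0; rewrite /Q quad_form_split.
have Lv := C0_L2 (C1_C0 dvC1) t0; have Lp := C0_L2 (C1_C0 dpC1) t0.
rewrite addr_ge0 ?mulr_ge0 ?ip_ge0 ?(ltW alpha1_gt0) ?(ltW beta_gt0)//.
have alg (g x y z : R) : x + 2 * (- g) * y + g ^+ 2 * z = g ^+ 2 * z - 2 * g * y + x.
  by ring.
(* The second part of the split form is the squared norm of p_x - gamma v_x. *)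
by have := ip_quad (- gamma) Lp Lv; rewrite sqrrN alg (ipC L (dx (p t))).
Qed.

Let is_derive_dq (a b : R -> R -> R) (t : R) : C1 a b -> 0 < t ->
  is_derive t 1 (fun s => ip L (a s) (a s)) (2 * ip L (a t) (b t)).
Proof.
move=> Cab t0; apply: (is_derive_congr (is_derive_ip Cab Cab t0)) => //.
by rewrite ipC; ring.
Qed.

Let dA (t : R) : 0 < t -> is_derive t 1 A (2 * M t).
Proof.
move=> t0.
have := is_deriveDZ 1 (is_derive_dq vC1 t0) (is_derive_dq pC1 t0).
move=> /is_derive_congr; apply; first by move=> s; rewrite mul1r.
by rewrite /M; ring.
Qed.

Let dD (t : R) : 0 < t -> is_derive t 1 D (2 * N t).
Proof.
move=> t0.
have := is_deriveDZ lambda2 (is_deriveZl lambda1 (is_derive_dq vC1 t0)) (is_derive_dq pC1 t0).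
move=> /is_derive_congr; apply; first by [].
by rewrite /N; ring.
Qed.

Let dMP (t : R) : 0 < t -> is_derive t 1 M (dM t).
Proof.
move=> t0.
have := is_deriveDZ 1 (is_derive_ip vC1 vtC1 t0) (is_derive_ip pC1 ptC1 t0).
move=> /is_derive_congr; apply; first by move=> s; rewrite mul1r.
by rewrite mul1r.
Qed.

Let dQ (t : R) : 0 < t -> is_derive t 1 Q
  (2 * (alpha * ip L (dx (v t)) (dx (vt t)) + beta * ip L (dx (p t)) (dx (pt t))
   - gamma * beta * (ip L (dx (p t)) (dx (vt t)) + ip L (dx (v t)) (dx (pt t))))).
Proof.
move=> t0.
have h := is_deriveDZ (- (2 * (gamma * beta)))
  (is_deriveZl alpha (is_derive_dq dvC1 t0)) (is_derive_ip dvC1 dpC1 t0).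
have := is_deriveDZ beta h (is_derive_dq dpC1 t0).
move=> /is_derive_congr; apply; first by move=> s; rewrite mulNr.
rewrite (ipC L (dx (vt t)) (dx (p t))); exact: quad_derivativeE.
Qed.

Let dK (t : R) : 0 < t -> is_derive t 1 K (2 * (ip L (vtt t) (vt t) + ip L (ptt t) (pt t))).
Proof.
move=> t0.
have := is_deriveDZ 1 (is_derive_dq vtC1 t0) (is_derive_dq ptC1 t0).
move=> /is_derive_congr; apply; first by move=> s; rewrite mul1r.
rewrite (ipC L (vt t) (vtt t)) (ipC L (pt t) (ptt t)); exact: kinetic_derivativeE.
Qed.

Let dS (t : R) : 0 < t -> is_derive t 1 S (ip L (F1 t) (vt t) + ip L (F2 t) (pt t)).
Proof. exact: (is_derive_source L_gt0 HG1 vC0H pC0H vC1 pC1). Qed.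

Let dH (t : R) : 0 < t -> is_derive t 1 H (KD t).
Proof.
move=> t0; have t0' := ltW t0.
have := is_deriveDZ (- 2^-1) (dS t0) (is_deriveDZ 1 (dQ t0) (dK t0)).
move=> /is_derive_congr; apply; first by move=> s; rewrite mul1r mulNr.
exact: dissipationE (weak_v t0 (vt_star t0')) (weak_p t0 (pt_star t0')).
Qed.

(** Testing with (v, p) gives K - Q plus the source pairing, which is at least eta S. In eta H the
    kinetic part is - (eta / 2) K, whence the weight 1 + eta / 2; the discarded surplus is (eta - 2)
    / 2 times Q. *)
Let dM_ge (t : R) : 0 < t -> (1 + eta / 2) * K t + eta * H t <= dM t + N t.
Proof.
move=> t0; have t0' := ltW t0.
have -> : dM t + N t = K t - Q t + (ip L (F1 t) (v t) + ip L (F2 t) (p t)).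
  have E1 := weak_v t0 (vH t0').2; have E2 := weak_p t0 (pH t0').2.
  rewrite (ipC L (vtt t) (v t)) (ipC L (vt t) (v t)) (ipC L (dx (p t)) (dx (v t))) in E1.
  rewrite (ipC L (ptt t) (p t)) (ipC L (pt t) (p t)) in E2.
  exact: virialE E1 E2.
have -> : (1 + eta / 2) * K t + eta * H t = K t - Q t + eta * S t - (eta - 2) / 2 * Q t.
  exact: concavity_gapE.
rewrite lerBlDr ler_wpDr//.
  by rewrite mulr_ge0 ?Q_ge0// divr_ge0// subr_ge0 ltW.
by rewrite lerD2l source_ge.
Qed.

Let cip (a b : R -> R -> R) : C0 a -> C0 b ->
  {within `[0, +oo[, continuous (fun s => ip L (a s) (b s))}.
Proof. exact: ip_continuous. Qed.

Let cZ (k : R) (f : R -> R) : {within `[0, +oo[, continuous f} ->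
  {within `[0, +oo[, continuous (fun s => k * f s)}.
Proof. by move=> cf x; apply: cvgM; [exact: cvg_cst|exact: cf]. Qed.

Let cDD (f g : R -> R) : {within `[0, +oo[, continuous f} ->
  {within `[0, +oo[, continuous g} -> {within `[0, +oo[, continuous (fun s => f s + g s)}.
Proof. by move=> cf cg x; apply: cvgD; [exact: cf|exact: cg]. Qed.

Let cB (f g : R -> R) : {within `[0, +oo[, continuous f} ->
  {within `[0, +oo[, continuous g} -> {within `[0, +oo[, continuous (fun s => f s - g s)}.
Proof. by move=> cf cg x; apply: cvgB; [exact: cf|exact: cg]. Qed.

Let v0 := C1_C0 vC1.
Let p0 := C1_C0 pC1.
Let vt0 := C1_C0 vtC1.
Let pt0 := C1_C0 ptC1.
Let dv0 := C1_C0 dvC1.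
Let dp0 := C1_C0 dpC1.

Let cQ : {within `[0, +oo[, continuous Q}.
Proof.
have c1 := @cZ alpha _ (cip dv0 dv0); have c2 := @cZ (2 * (gamma * beta)) _ (cip dv0 dp0).
have c3 := cDD (cB c1 c2) (@cZ beta _ (cip dp0 dp0)); exact: c3.
Qed.

Let cK : {within `[0, +oo[, continuous K}.
Proof. by have c := cDD (cip vt0 vt0) (cip pt0 pt0); exact: c. Qed.

(** The contrapositive, in terms of the solution at time 0 alone: it says H 0 <= 0, with the elastic
    energy in the expanded form in which it is differentiated. *)
Lemma global_solution_energy_ge0 :
  \int[mu]_(x in Om) I (v 0 x) (p 0 x) <=
  2^-1 * ((alpha * ip L (dx (v 0)) (dx (v 0))
    - 2 * (gamma * beta) * ip L (dx (v 0)) (dx (p 0)) + beta * ip L (dx (p 0)) (dx (p 0)))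
    + (ip L (vt 0) (vt 0) + ip L (pt 0) (pt 0))).
Proof.
rewrite -subr_le0 -/(S 0) -/(Q 0) -/(K 0) -/(H 0) leNgt; apply/negP => H0.
have L2v t : 0 <= t -> L2 L (v t) by exact: C0_L2.
have L2p t : 0 <= t -> L2 L (p t) by exact: C0_L2.
have L2vt t : 0 <= t -> L2 L (vt t) by exact: C0_L2.
have L2pt t : 0 <= t -> L2 L (pt t) by exact: C0_L2.
apply: (@concavity_blowup R A D M N K KD H dM eta) => //.
- have c := cDD (cip v0 v0) (cip p0 p0); exact: c.
- have c := cDD (@cZ lambda1 _ (cip v0 v0)) (@cZ lambda2 _ (cip p0 p0)); exact: c.
- have c := cDD (cip v0 vt0) (cip p0 pt0); exact: c.
- have c := cB (source_continuous L_gt0 HG1 vC0H pC0H vC1 pC1) (@cZ 2^-1 _ (cDD cQ cK)); exact: c.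
- by move=> t t0; rewrite addr_ge0 ?ip_ge0.
- by move=> t t0; rewrite addr_ge0 ?mulr_ge0 ?ip_ge0 ?ltW.
- by move=> t t0; rewrite addr_ge0 ?mulr_ge0 ?ip_ge0 ?ltW.
- move=> t r t0.
  have := addr_ge0 (ip_quad r (L2v t t0) (L2vt t t0)) (ip_quad r (L2p t t0) (L2pt t t0)).
  by congr (_ <= _); rewrite /A /M /K; ring.
- move=> t r t0.
  have := addr_ge0 (mulr_ge0 (ltW lambda1_gt0) (ip_quad r (L2v t t0) (L2vt t t0)))
                   (mulr_ge0 (ltW lambda2_gt0) (ip_quad r (L2p t t0) (L2pt t t0))).
  by congr (_ <= _); rewrite /D /N /KD; ring.
Qed.

End global_solution.

Theorem theorem4 (R : realType) (L alpha beta gamma lambda1 lambda2 : R)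
  (I f1 f2 : R -> R -> R) (eta : R) (v0 p0 v1 p1 : R -> R)
  (Tmax : \bar R) (v p : R -> R -> R) :
  0 < L -> 0 < alpha -> 0 < beta -> 0 < gamma -> 0 < lambda1 -> 0 < lambda2 ->
  0 < alpha - gamma ^+ 2 * beta ->
  G1 I f1 f2 -> 2 < eta -> G2 L I f1 f2 eta -> G3 f1 f2 ->
  (H2 L `&` H1star L) v0 -> (H2 L `&` H1star L) p0 ->
  H1star L v1 -> H1star L p1 ->
  crep L (wderiv L v0) L = 0 -> crep L (wderiv L p0) L = 0 ->
  initial_energy L alpha beta gamma v0 p0 v1 p1 I < 0 ->
  maximal_strong_solution L alpha beta gamma lambda1 lambda2 f1 f2
    v0 p0 v1 p1 Tmax v p ->
  (Tmax < +oo)%E.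
Proof.
move=> L_gt0 _ b_gt0 _ l1 l2 a1 HG1 eta2 HG2 _ [_ Hv0] [_ Hp0] Hv1 Hp1 _ _ E0.
move=> [[_ [vt [vtt [pt [ptt [[Rv Rp] eqv eqp [iv ivt ip0 ipt] bc]]]]]] _].
rewrite ltey; apply/eqP => T; subst Tmax.
have z0 : 0 <= 0 :> R by [].
have [[cv0 _] [_ [cvt _] _] [[Cv Cvt _] _]] := Rv.
have [[cp0 _] [_ [cpt _] _] [[Cp Cpt _] _]] := Rp.
have Lv := C0_L2 Cv z0; have Lvt := C0_L2 Cvt z0.
have Lp := C0_L2 Cp z0; have Lpt := C0_L2 Cpt z0.
have Hv : H1 L (v 0) := (cv0 0 ((time_domP 0).2 z0)).2.1.
have Hp : H1 L (p 0) := (cp0 0 ((time_domP 0).2 z0)).2.1.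
have eq1 t : 0 < t -> \forall x \ae (@lebesgue_measure R), Omega L x ->
    vtt t x - alpha * wderiv L (wderiv L (v t)) x
    + gamma * beta * wderiv L (wderiv L (p t)) x + lambda1 * vt t x = f1 (v t x) (p t x).
  by move=> t0; apply: eqv => //; exact: ltry.
have eq2 t : 0 < t -> \forall x \ae (@lebesgue_measure R), Omega L x ->
    ptt t x - beta * wderiv L (wderiv L (p t)) x
    + gamma * beta * wderiv L (wderiv L (v t)) x + lambda2 * pt t x = f2 (v t x) (p t x).
  by move=> t0; apply: eqp => //; exact: ltry.
have bc' t : 0 <= t -> crep L (wderiv L (v t)) L = 0 /\ crep L (wderiv L (p t)) L = 0.
  by move=> /time_domP /bc [].
have := global_solution_energy_ge0 L_gt0 b_gt0 l1 l2 a1 HG1 eta2 HG2 Rv Rp eq1 eq2 bc'.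
have mI (w q : R -> R) : L2 L w -> L2 L q ->
    measurable_fun (Omega L) (fun x => I (w x) (q x)).
  move=> Lw Lq; apply: measurable_fun_comp2; [|exact: L2_measurable|exact: L2_measurable].
  by case: HG1 => _ dI _ _ _ z; apply: differentiable_continuous.
have -> : \int[lebesgue_measure]_(x in Omega L) I (v 0 x) (p 0 x) =
          \int[lebesgue_measure]_(x in Omega L) I (v0 x) (p0 x).
  apply: eq_Rintegral_ae; [exact: mI|exact: (mI _ _ Hv0.1.1 Hp0.1.1)|].
  by apply: aeS2 iv ip0 => x e1 e2 xO; rewrite e1// e2.
apply/negP; rewrite -ltNge -subr_lt0; move: E0; rewrite /initial_energy.
(* The solution attains its data only almost everywhere; every term of the energy is carried over
   from the data to the solution at time 0. *)
rewrite -(wderiv_ext L_gt0 Lv Hv0.1.1 iv) -(wderiv_ext L_gt0 Lp Hp0.1.1 ip0).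
have Ldv := wderiv_L2 Hv; have Ldp := wderiv_L2 Hp.
have Lg := L2Z gamma Ldv; have Lgd := L2B Lg Ldp.
rewrite (L2norm_sqr Ldv) (L2norm_sqr Lgd) (L2norm_sqr Hv1.1.1) (L2norm_sqr Hp1.1.1).
rewrite -(ip_ae Lvt Hv1.1.1 Lvt Hv1.1.1 ivt ivt) -(ip_ae Lpt Hp1.1.1 Lpt Hp1.1.1 ipt ipt).
(* The stated energy has the square completed; expanding it lets [quad_form_split] match the two
   expressions. *)
have -> : ip L (fun x => gamma * wderiv L (v 0) x - wderiv L (p 0) x)
    (fun x => gamma * wderiv L (v 0) x - wderiv L (p 0) x) =
  gamma ^+ 2 * ip L (wderiv L (v 0)) (wderiv L (v 0))
  - 2 * gamma * ip L (wderiv L (v 0)) (wderiv L (p 0))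
  + ip L (wderiv L (p 0)) (wderiv L (p 0)).
  rewrite (ipBl Lg Ldp Lgd) (ipBr Lg Ldp Lg) (ipBr Lg Ldp Ldp).
  have e1 := ipZl gamma Ldv Lg; have e2 := ipZr gamma Ldv Ldv.
  have e3 := ipZl gamma Ldv Ldp; have e4 := ipZr gamma Ldv Ldp.
  exact: square_expandE e1 e2 e3 e4 (ipC L _ _).
by rewrite quad_form_split -!addrA.
Qed.
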